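(* Let $\psi:\mathbb{N}\to[0,1/2]$ be any function for which there exists a constant $\varepsilon>0$ such that $$\sum_{n=2}^\infty \frac{\psi(n)}{(\log n)^{\varepsilon}}=\infty.$$ Then $\lambda(W(\psi))=1$.
   Context: $\lambda$ denotes Lebesgue measure. For each positive integer $n$, let $\mathcal{E}_n\subseteq\mathbb{R}/\mathbb{Z}$ be $\mathcal{E}_n=\bigcup_{a=1}^n\left(\frac{a-\psi(n)}{n},\frac{a+\psi(n)}{n}\right)$ (taken modulo $1$). $W(\psi)$ denotes the set of $x\in[0,1)$ (identified with $\mathbb{R}/\mathbb{Z}$) which are contained in infinitely many of the sets $\mathcal{E}_n$. *)

(* Defs.v *)
From mathcomp Require Import all_boot all_order all_algebra.
From mathcomp Require Import all_classical all_reals all_analysis.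

Set Implicit Arguments.
Unset Strict Implicit.
Unset Printing Implicit Defensive.

Import Order.TTheory GRing.Theory Num.Theory.
Import numFieldNormedType.Exports.

Local Open Scope classical_set_scope.
Local Open Scope ring_scope.

(* R/Z is represented by [0, 1[; [mod1] is the projection R -> R/Z. *)
Definition mod1 (R : realType) (x : R) : R := x - (Num.floor x)%:~R.

(* The numerator [a] ranges over all of 1, ..., n, not only over the integers
   coprime to [n]. *)
Definition approx_set (R : realType) (psi : nat -> R) (n : nat) : set R :=
  @mod1 R @` \bigcup_(a in [set a : nat | (1 <= a <= n)%N])
    `](a%:R - psi n) / n%:R, (a%:R + psi n) / n%:R[%classic.

Definition well_approximable (R : realType) (psi : nat -> R) : set R :=
  `[0, 1[%classic `&`
  [set x | infinite_set [set n : nat | (0 < n)%N /\ approx_set psi n x]].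

(* Main.v *)
Require Import Defs.
From mathcomp Require Import all_boot all_order all_algebra.
From mathcomp Require Import all_classical all_reals all_analysis.
From mathcomp Require Import measurable_realfun.
From mathcomp Require Import ring lra zify.

Import Order.TTheory GRing.Theory Num.Theory.
Import numFieldNormedType.Exports.

Local Open Scope classical_set_scope.
Local Open Scope ring_scope.

Set Implicit Arguments.
Unset Strict Implicit.
Unset Printing Implicit Defensive.

(** Only reduced fractions a/n are used. The intersection of the sets of two
    denominators m = g u and n = g v, with u, v coprime, is governed by the
    solutions of 0 < |a v - b u| < D; each value r = |a v - b u| must be coprime
    to u v, and a count modulo g bounds the number of pairs (a, b) giving r.
    Replacing psi by psi / 2^k and averaging over k < K ~ delta log log n, the
    overlaps become a logarithmic sum over the r <= 2^K coprime to u v, which is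
    at most the expected size by Mertens' theorem, while primes above 2^K do not
    matter. Since (log n)^eps dominates a power of 2^K, there are blocks of
    denominators whose total measure is at least 1 on all of these scales, and
    the second moment method, averaged over the scales, gives a set of measure
    at least c, with c depending only on eps. The bound
    applies to every psi / j, so the set of x lying in infinitely many sets for
    every psi / j also has measure at least c; it is invariant under
    x |-> q x modulo 1 for every q, which forces it to have full measure. *)

(** * Prime number estimates *)

(** At a single scale the expected pair bound fails. The sum over [r <= D] coprime to [N = u v]
    contains the term [r = 1] as soon as [D >= 1], while the expected size [D * phi_ratio N] can be
    as small as order [1 / K]; a bound uniform in the scale would lose a factor of that order. Only
    the total over [K] dyadic values of [D] has the right size.

    Scale [k] is weighted by [4^k], which cancels the factor [4^-k] in the expected overlap of two
    intervals shrunk by [2^k], so that all scales count equally. The price is paid on the diagonal: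
    a set meets itself in measure proportional to [2^-k], so the weighted diagonal grows like [2^K]
    times the total mass. This is why a block is usable only when its mass is at least [2^K], and
    why the divergence hypothesis must supply a power of [2^K]. Denominators in a block lie below
    [2^2^(A K)], with [A] fixed by [eps], so they have few enough prime factors for those above
    [2^K] to change [phi(n) / n] by a bounded factor only. *)

Lemma ln_nat_ge0 {R : realType} (n : nat) : 0 <= ln (n%:R : R).
Proof. by case: n => [|n]; [rewrite ln0 | rewrite ln_ge0// ler1n]. Qed.

Lemma ln2_le1 {R : realType} : ln 2 <= 1 :> R.
Proof. by rewrite (_ : 2 = 1 + 1)// le_ln1Dx// (lt_trans (ltrN10 _)). Qed.

Lemma ln_prod_nat {R : realType} (r : seq nat) (P : pred nat) (F : nat -> nat) :
  (forall i, P i -> (0 < F i)%N) ->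
  ln ((\prod_(i <- r | P i) F i)%N%:R : R) = \sum_(i <- r | P i) ln (F i)%:R.
Proof.
move=> F0; elim: r => [|a r IH]; first by rewrite !big_nil ln1.
rewrite !big_cons; case: ifP => // Pa.
by rewrite natrM lnM ?IH// posrE ltr0n; [exact: F0 | exact: prodn_cond_gt0].
Qed.

(** The identity expressing [ln r] as the sum of the von Mangoldt function over the divisors of [r],
    with prime powers written as pairs [(p, j)]. The cutoff [n] does not depend on [r], so that sums
    over [r] and over [(p, j)] can be exchanged. *)
Lemma ln_prime_powers {R : realType} (n r : nat) : (0 < r <= n)%N ->
  ln (r%:R : R) = \sum_(1 <= p < n.+1 | prime p)
                   \sum_(1 <= j < n.+1 | (p ^ j %| r)%N) ln p%:R.
Proof.
case/andP=> r0 rn; rewrite -{1}[r](partnT r0) (widen_partn _ rn).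
rewrite ln_prod_nat; last by move=> [|i] _; rewrite ?expn_gt0//= lognE.
rewrite big_ltn//= lognE expn0 ln1 add0r [RHS]big_mkcond/=.
apply: eq_big_nat => p /andP[p1 pn].
case: ifP => pp; last by rewrite lognE pp/= expn0 ln1.
rewrite natrX lnXn ?ltr0n// [in RHS]big_const_seq iter_addr addr0; congr (_ *+ _).
transitivity (count (fun j => j <= logn p r)%N (index_iota 1 n.+1)); last first.
  by apply: eq_count => j /=; rewrite pfactor_dvdn.
have h : (logn p r <= n)%N by rewrite (leq_trans _ rn)// ltnW// ltn_logl.
rewrite -size_filter -[LHS](size_iota 1); apply/esym/perm_size/uniq_perm.
- by rewrite filter_uniq// iota_uniq.
- exact: iota_uniq.
- by move=> j; rewrite mem_filter mem_index_iota mem_iota; lia.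
Qed.

Lemma count_multiples (n d : nat) : (0 < d)%N ->
  (\sum_(1 <= r < n.+1 | d %| r) 1 = n %/ d)%N.
Proof.
move=> d0; elim: n => [|n IH]; first by rewrite big_geq// div0n.
by rewrite big_mkcond big_nat_recr//= -big_mkcond/= IH divnS// addnC; case: ifP.
Qed.

Definition chebyshev_psi {R : realType} (n : nat) : R :=
  \sum_(1 <= p < n.+1 | prime p) \sum_(1 <= j < n.+1 | (p ^ j <= n)%N) ln p%:R.

Lemma chebyshev_psi_widen {R : realType} (B n : nat) : (n <= B)%N ->
  chebyshev_psi n = \sum_(1 <= p < B.+1 | prime p)
     \sum_(1 <= j < B.+1 | (p ^ j <= n)%N) ln (p%:R : R).
Proof.
move=> nB; rewrite /chebyshev_psi [RHS](big_cat_nat _ (n := n.+1))//=.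
rewrite [X in _ + X]big_nat_cond [X in _ + X]big1 ?addr0; last first.
  move=> p /andP[/andP[np _] pp]; rewrite big_nat_cond big1// => j /andP[/andP[j1 _] pj].
  have := leq_trans (leq_pexp2l (prime_gt0 pp) j1) pj; rewrite expn1; lia.
apply: eq_bigr => p pp; rewrite [RHS](big_cat_nat _ (n := n.+1))//=.
rewrite [X in _ + X]big_nat_cond [X in _ + X]big1 ?addr0// => j /andP[/andP[nj _] pj].
have := ltn_expl j (prime_gt1 pp); lia.
Qed.

(** Legendre's formula, again with a free cutoff so that [n!] and [(2n)!] can be compared term by
    term. *)
Lemma ln_fact {R : realType} (B n : nat) : (n <= B)%N ->
  ln (n`!%:R : R) = \sum_(1 <= p < B.+1 | prime p)
                     \sum_(1 <= j < B.+1) (n %/ p ^ j)%:R * ln p%:R.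
Proof.
move=> nB; rewrite fact_prod.
have -> : (\prod_(1 <= i < n.+1) i = \prod_(1 <= i < n.+1 | (0 < i)) i)%N.
  by rewrite [RHS]big_mkcond; apply: eq_big_nat => i /andP[->].
rewrite ln_prod_nat// [LHS]big_mkcond/=.
transitivity (\sum_(1 <= r < n.+1) \sum_(1 <= p < B.+1 | prime p)
    \sum_(1 <= j < B.+1) (if (p ^ j %| r)%N then ln (p%:R : R) else 0)).
  apply: eq_big_nat => r /andP[r1 rn]; rewrite r1 (@ln_prime_powers _ B) ?r1//=; last lia.
  by apply: eq_bigr => p _; rewrite big_mkcond.
rewrite exchange_big/=; apply: eq_bigr => p pp.
rewrite exchange_big/=; apply: eq_bigr => j _.
rewrite -big_mkcond/= -(@count_multiples n (p ^ j)) ?expn_gt0 ?prime_gt0//.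
rewrite natr_sum mulr_suml; apply: eq_bigr => r _; rewrite mul1r//.
Qed.

(** Chebyshev's argument: the central binomial coefficient is at most [2^(2n)], and in its logarithm
    each prime power [d = p ^ j] has coefficient [n.*2 %/ d - 2 * (n %/ d)], which is nonnegative
    and at least 1 when [n < d <= 2n]. *)
Lemma chebyshev_psi_double {R : realType} (n : nat) :
  chebyshev_psi n.*2 <= chebyshev_psi n + n.*2%:R * ln 2 :> R.
Proof.
have H : ln ('C(n.*2, n)%:R : R) <= n.*2%:R * ln 2.
  rewrite mulr_natl -lnXn// ler_ln ?posrE ?ltr0n ?bin_gt0 -?natrX ?ltr0n ?expn_gt0//; last by lia.
  rewrite ler_nat (_ : 2 ^ n.*2 = (1 + 1) ^ n.*2)%N// expnDn.
  have nn : (n < n.*2.+1)%N by lia.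
  by rewrite (bigD1 (Ordinal nn))//= !exp1n !muln1 leq_addr.
rewrite -lerBlDl; apply: le_trans H.
have -> : ln ('C(n.*2, n)%:R : R) = ln (n.*2`!%:R) - ln n`!%:R - ln n`!%:R.
  have /(congr1 (fun m => ln (m%:R : R))) : ('C(n.*2, n) * (n`! * n`!) = n.*2`!)%N.
    by rewrite -(@bin_fact n.*2 n) -?addnn ?leq_addr// addnK.
  rewrite natrM lnM ?posrE ?ltr0n ?bin_gt0 ?muln_gt0 ?fact_gt0//; last by lia.
  rewrite natrM lnM ?posrE ?ltr0n ?fact_gt0// => <-; ring.
have n2 : (n <= n.*2)%N by lia.
rewrite !(@ln_fact R n.*2)// (chebyshev_psi_widen n2) /chebyshev_psi.
rewrite -!sumrB; apply: ler_sum => p pp; rewrite -!sumrB big_mkcond [X in _ - X]big_mkcond -sumrB.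
apply: ler_sum => j _; set d := (p ^ j)%N.
have d0 : (0 < d)%N by rewrite expn_gt0 prime_gt0.
have H b : (if b then ln (p%:R : R) else 0) = b%:R * ln p%:R by case: b; rewrite ?mul1r ?mul0r.
rewrite !H -!mulrBl ler_wpM2r ?ln_nat_ge0//.
have : ((d <= n.*2) + n %/ d + n %/ d <= n.*2 %/ d + (d <= n))%N.
  rewrite -addnA addnn -!muln2.
  have [dn|dn] := leqP d n.
    have -> : (d <= n * 2)%N by lia.
    by rewrite addnC leq_add2r leq_divRL// mulnAC leq_mul// leq_trunc_div.
  rewrite (divn_small dn) mul0n !addn0.
  by have [dn2|//] := leqP d (n * 2); rewrite divn_gt0.
rewrite -(ler_nat R) !natrD; lra.
Qed.

(** Doubling from [uphalf n <= (n + 1) / 2]. With [ln 2 <= 1] the induction step asks for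
    [4 (n + 1) <= 6 n], true from [n = 2] on, whence the constant 6. *)
Lemma chebyshev_psi_le {R : realType} (n : nat) : chebyshev_psi n <= 6 * n%:R :> R.
Proof.
elim/ltn_ind: n => n IH.
have [n1|n1] := leqP n 1.
  rewrite /chebyshev_psi big_nat_cond big1 ?mulr_ge0// => p /andP[/andP[p1 pn] pp].
  by move: (prime_gt1 pp); lia.
have l2 : ln (2 : R) <= 1.
  exact: ln2_le1.
have un : (uphalf n < n)%N by rewrite uphalf_half; lia.
have n2u : (n <= (uphalf n).*2)%N by rewrite uphalf_half; lia.
have h : chebyshev_psi n <= chebyshev_psi (uphalf n).*2 :> R.
  rewrite (chebyshev_psi_widen n2u) /chebyshev_psi; apply: ler_sum => p pp.
  rewrite big_mkcond [leRHS]big_mkcond; apply: ler_sum => j _.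
  by case: ifP => [pn|_]; [rewrite (leq_trans pn n2u) | case: ifP; rewrite ?ln_nat_ge0].
apply: le_trans h _; apply: le_trans (chebyshev_psi_double _) _.
have := IH _ un; have : 2 * (uphalf n)%:R <= n%:R + 1 :> R.
  by rewrite -natrM natr1 ler_nat uphalf_half; lia.
have : 2 <= n%:R :> R by rewrite ler_nat.
rewrite -muln2 natrM; have : 0 <= (uphalf n)%:R :> R by [].
move: (uphalf n)%:R (chebyshev_psi _) (n%:R : R) l2 => u S x; nra.
Qed.

(** Replacing [n %/ p] by [n / p] in Legendre's formula costs at most [ln p] for each prime, in
    total at most [chebyshev_psi n <= 6 n], while [ln n!] is at most [n ln n]. *)
Lemma mertens_first {R : realType} (n : nat) : (0 < n)%N ->
  \sum_(1 <= p < n.+1 | prime p) ln p%:R / p%:R <= ln (n%:R : R) + 6.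
Proof.
move=> n0; have nR : 0 < n%:R :> R by rewrite ltr0n.
have H : n%:R * (\sum_(1 <= p < n.+1 | prime p) ln p%:R / p%:R) <= ln n`!%:R + chebyshev_psi n :> R.
  rewrite (@ln_fact R n n)// /chebyshev_psi -big_split/= mulr_sumr.
  rewrite big_mkcond [leRHS]big_mkcond; apply: ler_sum_nat => p /andP[p1 pn].
  case: ifP => // pp.
  rewrite [X in _ + X]big_mkcond -big_split/= big_ltn// expn1 -ltnS pn.
  rewrite -[leLHS]addr0; apply: lerD; last first.
    by apply: sumr_ge0 => j _; rewrite addr_ge0// ?mulr_ge0 ?ln_nat_ge0//; case: ifP; rewrite ?ln_nat_ge0.
  rewrite [leRHS](_ : _ = ((n %/ p)%:R + 1) * ln p%:R); last by ring.
  rewrite mulrCA mulrC ler_wpM2r ?ln_nat_ge0//.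
  rewrite ler_pdivrMr ?ltr0n// natr1 -natrM ler_nat.
  by rewrite {1}(divn_eq n p); have := ltn_pmod n p1; nia.
have Hf : ln n`!%:R <= n%:R * ln n%:R :> R.
  rewrite mulr_natl -lnXn// ler_ln ?posrE ?ltr0n ?fact_gt0 ?exprn_gt0// -natrX ler_nat.
  suff h k m : (k <= m -> k`! <= m ^ k)%N by exact: h.
  by elim: k => // k IH km; rewrite factS expnS leq_mul// IH// ltnW.
have := @chebyshev_psi_le R n; move=> H2.
by rewrite -(ler_pM2l nR) mulrDr; lra.
Qed.

(* Summation by parts: [Phi n] differs from the sum of [1/p] by a nonnegative
   amount and grows no faster than [ln (ln n)]. *)
Lemma sum_inv_prime_le {R : realType} : exists C : R, forall n, (1 < n)%N ->
  \sum_(1 <= p < n.+1 | prime p) p%:R^-1 <= ln (ln n%:R) + C.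
Proof.
pose H n : R := \sum_(1 <= p < n.+1 | prime p) p%:R^-1.
pose A n : R := \sum_(1 <= p < n.+1 | prime p) ln p%:R / p%:R.
pose Phi n : R := H n + (ln n%:R + 6 - A n) / ln n%:R.
have ln0 n : (1 < n)%N -> 0 < ln (n%:R : R) by move=> n1; rewrite ln_gt0// ltr1n.
have PhiS n : (1 < n)%N -> Phi n.+1 <= Phi n + (ln (ln n.+1%:R) - ln (ln n%:R)).
  move=> n1; rewrite /Phi; set a := (if prime n.+1 then n.+1%:R^-1 else 0) : R.
  have HS : H n.+1 = H n + a by rewrite /H [LHS]big_mkcond/= big_nat_recr//= -big_mkcond.
  have AS : A n.+1 = A n + a * ln n.+1%:R.
    rewrite /A [LHS]big_mkcond/= big_nat_recr//= -big_mkcond/=; congr (_ + _).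
    by rewrite /a; case: ifP => _; rewrite ?mul0r// mulrC.
  set u := ln (n%:R : R); set v := ln (n.+1%:R : R).
  have u0 : 0 < u by exact: ln0.
  have uv : u <= v by rewrite ler_ln ?posrE ?ltr0n ?ler_nat//; lia.
  have v0 : 0 < v by exact: lt_le_trans uv.
  have B0 : 0 <= u + 6 - A n by rewrite subr_ge0 mertens_first//; lia.
  have -> : H n.+1 + (v + 6 - A n.+1) / v = H n + (u + 6 - A n) / v + (v - u) / v.
    by rewrite HS AS -/v; field; rewrite gt_eqF.
  apply: lerD; first by rewrite lerD2l ler_wpM2l// lef_pV2 ?posrE.
  have -> : ln v - ln u = - ln (u / v) by rewrite ln_div ?posrE//; ring.
  have : ln (1 + (u / v - 1)) <= u / v - 1.
    by rewrite le_ln1Dx// ltrBrDl subrr divr_gt0.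
  rewrite addrC subrK => h; rewrite lerNr; apply: le_trans h _.
  by rewrite mulrBl divff ?gt_eqF//; lra.
exists (Phi 2 - ln (ln 2)) => n n1.
suff : Phi n <= ln (ln n%:R) + (Phi 2 - ln (ln 2)).
  apply: le_trans; rewrite /Phi lerDl divr_ge0 ?(ltW (ln0 _ _))//.
  by rewrite subr_ge0 mertens_first//; lia.
elim: n n1 => // n IH; rewrite ltnS leq_eqVlt => /orP[/eqP<-|n1]; first by lra.
have := IH n1; have := PhiS _ n1; lra.
Qed.

Lemma sum_inv_mul_pred_le {R : realType} (n : nat) :
  \sum_(1 <= p < n.+1 | prime p) (p%:R * (p%:R - 1))^-1 <= 1 :> R.
Proof.
case: n => [|n]; first by rewrite big_geq.
suff : \sum_(1 <= p < n.+2 | prime p) (p%:R * (p%:R - 1))^-1 <= 1 - n.+1%:R^-1 :> R.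
  by move=> h; apply: le_trans h _; rewrite gerBl invr_ge0.
elim: n => [|n IH]; first by rewrite big_mkcond big_nat1/= invr1 subrr.
rewrite big_mkcond big_nat_recr//= -big_mkcond/=.
apply: le_trans (lerD IH (_ : _ <= (n.+2%:R * (n.+2%:R - 1))^-1)) _.
  by case: ifP => // _; rewrite invr_ge0 mulr_ge0// subr_ge0 ler1n.
rewrite -!natr1 le_eqVlt; apply/orP; left; apply/eqP; field.
by have : 0 <= n%:R :> R by []; lra.
Qed.

Lemma prime_factor_gt0 {R : realType} (p : nat) : prime p -> 0 < 1 - p%:R^-1 :> R.
Proof. by move/prime_gt1 => p1; rewrite subr_gt0 invf_lt1 ?ltr1n// ltr0n; lia. Qed.

Lemma prime_factor_le1 {R : realType} (p : nat) : 1 - p%:R^-1 <= 1 :> R.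
Proof. by rewrite gerBl invr_ge0. Qed.

(** The factor at [p] is exactly [1 + 1/p + 1/(p (p - 1))], hence at most the exponential of the
    last two terms; the first sums to [ln (ln n)] up to a constant and the second to at most 1. *)
Lemma mertens_product {R : realType} : exists2 C : R, 0 < C &
  forall n, (1 < n)%N ->
  \prod_(1 <= p < n.+1 | prime p) (1 - p%:R^-1)^-1 <= C * ln n%:R.
Proof.
have [C HC] := @sum_inv_prime_le R; exists (expR (C + 1)); first exact: expR_gt0.
move=> n n1.
apply: (@le_trans _ _ (\prod_(1 <= p < n.+1 | prime p) expR (p%:R^-1 + (p%:R * (p%:R - 1))^-1))).
  apply: ler_prod => p pp; rewrite invr_ge0 (ltW (prime_factor_gt0 pp))/=.
  apply: le_trans (expR_ge1Dx _); rewrite le_eqVlt; apply/orP; left; apply/eqP; field.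
  by have := prime_gt1 pp; rewrite subr_eq0 pnatr_eq1 pnatr_eq0; lia.
rewrite -expR_sum big_split/= -[X in _ * X]lnK ?posrE ?ln_gt0 ?ltr1n//.
rewrite -expRD ler_expR; have := HC _ n1; have := @sum_inv_mul_pred_le R n; lra.
Qed.

(** Brings products over the prime divisors of different integers to one range, so that they can be
    compared prime by prime. *)
Lemma big_primes {R : realType} (N B : nat) (F : nat -> R) : (0 < N <= B)%N ->
  \prod_(p <- primes N) F p =
  \prod_(1 <= p < B.+1 | prime p) (if (p %| N)%N then F p else 1).
Proof.
move=> /andP[N0 NB]; rewrite -big_mkcondr -[RHS]big_filter; apply/perm_big/uniq_perm.
- exact: primes_uniq.
- exact/filter_uniq/iota_uniq.
- move=> p; rewrite mem_filter mem_index_iota mem_primes N0/=.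
  case: (boolP (prime p)) => //= pp; case: (boolP (p %| N)%N) => //= pN.
  by rewrite prime_gt0// ltnS (leq_trans _ NB)// dvdn_leq.
Qed.

(** * Sums over integers coprime to a given one *)

(** Euler's [phi(n) / n]. *)
Definition phi_ratio {R : realType} (n : nat) : R := \prod_(p <- primes n) (1 - p%:R^-1).

Definition phi_ratio_upto {R : realType} (x N : nat) : R :=
  \prod_(1 <= p < x.+1 | prime p && (p %| N)%N) (1 - p%:R^-1).

Lemma phi_ratioE {R : realType} (x N : nat) : (0 < N <= x)%N ->
  phi_ratio N = phi_ratio_upto x N :> R.
Proof. by move=> Nx; rewrite /phi_ratio_upto big_mkcondr -(big_primes _ Nx). Qed.

Lemma phi_ratio_gt0 {R : realType} (n : nat) : 0 < phi_ratio n :> R.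
Proof.
rewrite /phi_ratio big_seq prodr_gt0// => p; rewrite mem_primes => /andP[pp _].
exact: prime_factor_gt0.
Qed.

Lemma phi_ratio_upto_gt0 {R : realType} (x n : nat) : 0 < phi_ratio_upto x n :> R.
Proof. by rewrite prodr_gt0// => p /andP[pp _]; exact: prime_factor_gt0. Qed.

Lemma phi_ratio_upto_anti {R : realType} (x y N : nat) : (x <= y)%N ->
  phi_ratio_upto y N <= phi_ratio_upto x N :> R.
Proof.
move=> xy; rewrite /phi_ratio_upto (@big_cat_nat _ _ _ x.+1 1 y.+1)//=.
rewrite ler_piMr ?(ltW (phi_ratio_upto_gt0 _ _))//.
by apply: prodr_ile1 => p /andP[pp _]; rewrite (ltW (prime_factor_gt0 pp)) prime_factor_le1.
Qed.

Lemma size_primes_log (N k : nat) : (0 < N < 2 ^ k)%N -> (size (primes N) <= k)%N.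
Proof.
move=> /andP[N0 Nk]; rewrite -(@leq_exp2l 2)// (leq_trans _ (ltnW Nk))//.
rewrite [leqRHS](prod_prime_decomp N0) prime_decompE big_map/=.
have -> : (2 ^ size (primes N) = \prod_(p <- primes N) 2)%N.
  by rewrite big_const_seq count_predT iter_muln_1.
rewrite big_seq [leqRHS]big_seq; elim/big_ind2: _ => // [*|p pN]; first exact: leq_mul.
have pp : prime p by move: pN; rewrite mem_primes => /andP[].
by rewrite -{1}(expn0 p) ltn_exp2l ?prime_gt1// logn_gt0.
Qed.

(** It suffices to bound the sum of [1/p] over the primes [p > 2^K] dividing [N], because
    [1 - u >= exp (- 2 u)] for [0 <= u <= 1/2]. Up to [Y = 2^(A K)] Mertens' first theorem does so,
    as [ln p >= K ln 2] there; beyond [Y] each term is below [1 / Y], and [N] has at most [2 Y]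
    prime factors. *)
Lemma phi_ratio_upto_le {R : realType} (A : nat) : exists2 C : R, 0 < C &
  forall K N, (0 < K)%N -> (0 < N < 2 ^ (2 * 2 ^ (A * K)))%N ->
  phi_ratio_upto (2 ^ K) N <= C * phi_ratio N.
Proof.
have l2 : 0 < ln (2 : R) by rewrite ln_gt0// ltr1n.
exists (expR (2 * (A%:R + 6 / ln 2 + 2))) => [|K N K0 HN]; first exact: expR_gt0.
set Y := (2 ^ (A * K))%N in HN *; pose x := (N + 2 ^ K + Y)%N.
have [N0 N2] := andP HN.
have Y0 : (0 < Y)%N by rewrite expn_gt0.
have Y0R : 0 < Y%:R :> R by rewrite ltr0n.
rewrite (@phi_ratioE _ x); last by rewrite N0 /x -addnA leq_addr.
rewrite /phi_ratio_upto [X in _ * X](@big_cat_nat _ _ _ (2 ^ K).+1 1 x.+1)//=; last first.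
  by rewrite ltnS /x addnAC leq_addl.
rewrite mulrCA ler_peMr//; first exact/ltW/phi_ratio_upto_gt0.
(* A majorant of [1/p] at every prime [p > 2^K] dividing [N]: the first summand serves [p <= Y], the
   second [p > Y]. *)
pose b p : R := (if (p <= Y)%N then ln p%:R / p%:R else 0) / (K%:R * ln 2) + (p %| N)%N%:R / Y%:R.
have KR : 0 < K%:R * ln 2 :> R by rewrite mulr_gt0 ?ltr0n.
have b0 p : 0 <= b p.
  rewrite addr_ge0// divr_ge0// ?(ltW KR)//; case: ifP => // _.
  by rewrite divr_ge0 ?ln_nat_ge0.
have bS : \sum_(1 <= p < x.+1 | prime p) b p <= A%:R + 6 / ln 2 + 2.
  rewrite big_split/= -!mulr_suml; apply: lerD.
    have -> : \sum_(1 <= p < x.+1 | prime p) (if (p <= Y)%N then ln p%:R / p%:R else 0) =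
              \sum_(1 <= p < Y.+1 | prime p) ln p%:R / p%:R :> R.
      rewrite (@big_cat_nat _ _ _ Y.+1 1 x.+1)//=; last by rewrite ltnS leq_addl.
      rewrite [X in _ + X]big_nat_cond [X in _ + X]big1 ?addr0; last first.
        by move=> p /andP[/andP[Yp _] _]; rewrite leqNgt Yp.
      by rewrite big_mkcond [RHS]big_mkcond; apply: eq_big_nat => p /andP[_]; rewrite ltnS => ->.
    rewrite ler_pdivrMr//; apply: le_trans (mertens_first Y0) _.
    have -> : ln Y%:R = A%:R * (K%:R * ln 2) :> R.
      by rewrite natrX lnXn// mulrA -natrM [RHS]mulr_natl.
    rewrite mulrDl lerD2l.
    have -> : 6 / ln 2 * (K%:R * ln 2) = 6 * K%:R :> R by field; rewrite gt_eqF.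
    by rewrite ler_peMr// ler1n.
  rewrite ler_pdivrMr// -natr_sum -natrM ler_nat.
  rewrite (_ : (\sum_(1 <= p < x.+1 | prime p) (p %| N))%N = size (primes N)); last first.
    rewrite -big_mkcondr/= sum1_count -size_filter; apply/perm_size/uniq_perm.
    - exact/filter_uniq/iota_uniq.
    - exact: primes_uniq.
    - move=> p; rewrite mem_filter mem_index_iota mem_primes N0/=.
      case: (boolP (prime p)) => //= pp; case: (boolP (p %| N)%N) => //= pN.
      by rewrite prime_gt0// ltnS /x -addnA (leq_trans (dvdn_leq N0 pN))// leq_addr.
  by apply: size_primes_log.
apply: (@le_trans _ _ (expR (2 * (A%:R + 6 / ln 2 + 2)) *
    \prod_((2 ^ K).+1 <= p < x.+1 | prime p && (p %| N)%N) expR (- (2 * b p)))); last first.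
  rewrite ler_wpM2l ?expR_ge0//.
  rewrite big_nat_cond [leRHS]big_nat_cond; apply: ler_prod => p /andP[/andP[Kp _] /andP[pp pN]].
  rewrite expR_ge0/=.
  have p2 : 2 <= p%:R :> R by rewrite ler_nat prime_gt1.
  have p0 : 0 < p%:R :> R by lra.
  have : p%:R^-1 <= b p.
    rewrite /b pN; case: leqP => pY.
      rewrite -[leLHS]addr0 lerD ?divr_ge0//.
      rewrite mulrAC ler_peMl ?invr_ge0 ?ler0n// ler_pdivlMr// mul1r.
      rewrite mulr_natl -lnXn// ler_ln ?posrE ?exprn_gt0// -natrX ler_nat ltnW//.
    by rewrite mul0r add0r mul1r lef_pV2 ?posrE// ler_nat ltnW.
  move=> h; apply: (@le_trans _ _ (expR (- (2 * p%:R^-1)))).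
    by rewrite ler_expR lerN2 ler_pM2l.
  rewrite expRN -[leRHS]invrK lef_pV2 ?posrE ?expR_gt0 ?invr_gt0 ?prime_factor_gt0//.
  apply: le_trans (expR_ge1Dx _).
  set u : R := p%:R^-1.
  have u0 : 0 < u by rewrite invr_gt0.
  have u12 : u <= 1 / 2 by rewrite div1r lef_pV2 ?posrE.
  rewrite -[leLHS]mul1r ler_pdivrMr; nra.
rewrite -expR_sum -expRD -[leLHS](@expR0 R) ler_expR sumrN -mulr_sumr subr_ge0 ler_pM2l//.
apply: le_trans bS.
rewrite [leRHS](@big_cat_nat _ _ _ (2 ^ K).+1 1 x.+1)//=; last first.
  by rewrite ltnS /x addnAC leq_addl.
rewrite -[leLHS]add0r; apply: lerD; first by apply: sumr_ge0.
rewrite big_mkcond [leRHS]big_mkcond; apply: ler_sum => p _.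
by case: (prime p); case: (p %| N)%N.
Qed.

Lemma phi_ratioM_prime {R : realType} (p r : nat) : prime p -> (0 < r)%N ->
  phi_ratio (p * r) = (if (p %| r)%N then 1 else 1 - p%:R^-1) * phi_ratio r :> R.
Proof.
move=> pp r0; case: ifPn => pr.
  rewrite mul1r; apply/perm_big/uniq_perm; rewrite ?primes_uniq// => q.
  rewrite !mem_primes muln_gt0 prime_gt0// r0/=; case: (boolP (prime q)) => //= qq.
  by rewrite Euclid_dvdM// dvdn_prime2//; case: eqP => // ->.
transitivity (\prod_(q <- p :: primes r) (1 - q%:R^-1) : R); last by rewrite big_cons.
apply/perm_big/uniq_perm; rewrite /= ?primes_uniq ?andbT//.
  by rewrite mem_primes pp r0/=.
move=> q; rewrite inE !mem_primes muln_gt0 prime_gt0// r0/=.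
case: (boolP (prime q)) => /= qq; first by rewrite Euclid_dvdM// dvdn_prime2.
by rewrite orbF; apply/esym/negbTE; apply: contra qq => /eqP->.
Qed.

Lemma phi_ratio1 {R : realType} : phi_ratio 1 = 1 :> R.
Proof. by rewrite /phi_ratio big_nil. Qed.

Lemma sum_multiples {R : realType} (d n : nat) (G : nat -> R) : (0 < d)%N ->
  \sum_(1 <= r < n.+1 | (d %| r)%N) G r = \sum_(1 <= s < (n %/ d).+1) G (d * s)%N.
Proof.
move=> d0; elim: n => [|n IH]; first by rewrite div0n !big_geq.
rewrite big_mkcond big_nat_recr//= -big_mkcond/= IH divnS//; case: ifP => dn; last by rewrite addr0.
rewrite add1n [RHS]big_nat_recr//=; congr (_ + _); congr G.
by rewrite -[LHS](divnK dn) divnS// dn add1n mulnC.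
Qed.

(* Split off the multiples of [p]: writing them as [p * s], their sum is at most
   [1/p] times the whole sum, up to the correction coming from [s] prime to [p]. *)
Lemma smooth_sum_step {R : realType} (A : nat_pred) (p n : nat) : prime p -> p \notin A ->
  (1 - p%:R^-1) * \sum_(1 <= r < n.+1 | pnat [pred q | (q == p) || (q \in A)] r) (phi_ratio r)^-1 / r%:R
  <= (1 + (p%:R * (p%:R - 1))^-1) *
     \sum_(1 <= r < n.+1 | pnat A r) (phi_ratio r)^-1 / r%:R :> R.
Proof.
move=> pp Ap; pose A' := [pred q | (q == p) || (q \in A)]; rewrite -/A'.
pose F r : R := (phi_ratio r)^-1 / r%:R.
have F0 r : 0 <= F r by rewrite divr_ge0// invr_ge0 ltW// phi_ratio_gt0.
set S := \sum_(_ <= _ < _ | pnat A _) _; set S' := \sum_(_ <= _ < _ | _) _.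
have SA : S = \sum_(1 <= r < n.+1 | pnat A' r && ~~ (p %| r)%N) F r.
  rewrite /S; rewrite big_nat_cond [RHS]big_nat_cond; apply: eq_bigl => r.
  case: (boolP (1 <= r < n.+1)%N) => //= /andP[r0 _].
  apply/idP/andP => [rA|[rA' pr]].
    split; first by apply: sub_in_pnat rA => q _ qA; rewrite !inE/= qA orbT.
    apply/negP => pr; move/pnatP : rA => /(_ r0 p pp pr); exact/negP.
  apply/pnatP => // q qq qr; move/pnatP : rA' => /(_ r0 q qq qr); rewrite !inE.
  by case: eqP => [qp|_ //]; rewrite -qp qr in pr.
have p1 : 1 < p%:R :> R by rewrite ltr1n prime_gt1.
have FpE s : (0 < s)%N -> F (p * s)%N = F s / p%:R +
    (if (p %| s)%N then 0 else F s * (p%:R * (p%:R - 1))^-1).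
  move=> s0; rewrite /F phi_ratioM_prime// natrM; have := @phi_ratio_gt0 R s.
  have : 0 < s%:R :> R by rewrite ltr0n.
  move=> s0R f0; case: ifP => _; field; rewrite !gt_eqF//; lra.
suff : S' <= S + (S' / p%:R + S * (p%:R * (p%:R - 1))^-1).
  rewrite mulrBl mul1r [p%:R^-1 * _]mulrC mulrDl mul1r [_^-1 * S]mulrC; lra.
rewrite {1}/S' (bigID (fun r => p %| r)%N)/= addrC -SA lerD2l.
have -> : \sum_(1 <= r < n.+1 | pnat A' r && (p %| r)%N) F r =
    \sum_(1 <= s < (n %/ p).+1 | pnat A' s) F (p * s)%N.
  under eq_bigl do rewrite andbC.
  rewrite big_mkcondr/= sum_multiples ?prime_gt0// [RHS]big_mkcond.
  apply: eq_big_nat => s /andP[s0 _]; rewrite pnatM (_ : pnat A' p)//.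
  by rewrite pnatE// !inE eqxx.
apply: (@le_trans _ _ (\sum_(1 <= s < n.+1 | pnat A' s) F (p * s)%N)).
  rewrite [leRHS](@big_cat_nat _ _ _ (n %/ p).+1 1 n.+1)//= ?ltnS ?leq_div//.
  by rewrite lerDl sumr_ge0.
rewrite SA /S' mulr_suml mulr_suml [X in _ + X]big_mkcondr/= -big_split/=.
by rewrite big_nat_cond [leRHS]big_nat_cond; apply: ler_sum => s /andP[/andP[s0 _] _];
   rewrite FpE//; case: ifP.
Qed.

(** The summand is [1 / phi(r)], and the bound is its Euler product: the factor at [p] equals
    [1 + p / (p - 1)^2], the sum of [1 / phi(p^j)] over [j >= 0]. *)
Lemma smooth_sum_le {R : realType} (ps : seq nat) (n : nat) : uniq ps -> all prime ps ->
  \sum_(1 <= r < n.+1 | pnat [pred q | q \in ps] r) (phi_ratio r)^-1 / r%:R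
  <= \prod_(p <- ps) ((1 - p%:R^-1)^-1 * (1 + (p%:R * (p%:R - 1))^-1)) :> R.
Proof.
elim: ps => [|p ps IH] /=.
  move=> _ _; rewrite big_nil; case: n => [|n]; first by rewrite big_geq.
  rewrite big_mkcond big_ltn//= phi_ratio1 invr1 mulr1 big1_seq ?addr0// => r /andP[_].
  rewrite mem_index_iota => /andP[r2 _]; case: ifP => // /pnatP h.
  have := h (ltnW r2) _ (pdiv_prime r2) (pdiv_dvd r); rewrite inE//.
move=> /andP[pps ups] /andP[pp aps]; rewrite big_cons.
have f0 : 0 < 1 - p%:R^-1 :> R by exact: prime_factor_gt0.
have p1 : 1 < p%:R :> R by rewrite ltr1n prime_gt1.
rewrite -mulrA -(ler_pM2l f0) mulVKf ?gt_eqF//.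
have := @smooth_sum_step R [pred q | q \in ps] p n pp pps.
rewrite (eq_bigl (pnat [pred q | q \in p :: ps])); last first.
  by move=> r; apply: eq_pnat => q; rewrite !inE.
move/le_trans; apply; rewrite ler_wpM2l ?IH// addr_ge0// invr_ge0 mulr_ge0//; lra.
Qed.

(** Every [r <= n] coprime to [N] is composed of primes up to [n] not dividing [N]. Their Euler
    product is the full Mertens product with the primes dividing [N] removed, which is what
    [phi_ratio_upto n N] accounts for; the convergent factor is absorbed in [expR 1]. *)
Lemma coprime_sum_inv_le {R : realType} : exists2 C : R, 0 < C &
  forall N n, (1 < n)%N ->
  \sum_(1 <= r < n.+1 | coprime r N) (phi_ratio r)^-1 / r%:R <=
  C * ln n%:R * phi_ratio_upto n N.
Proof.
have [C C0 HC] := @mertens_product R.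
exists (expR 1 * C) => [|N n n1]; first by rewrite mulr_gt0 ?expR_gt0.
pose ps := [seq p <- index_iota 1 n.+1 | prime p && ~~ (p %| N)%N].
apply: (@le_trans _ _ (\sum_(1 <= r < n.+1 | pnat [pred q | q \in ps] r) (phi_ratio r)^-1 / r%:R)).
  rewrite big_mkcond [leRHS]big_mkcond; apply: ler_sum_nat => r /andP[r0 rn].
  case: ifPn => [rN|_]; last by case: ifP => // _; rewrite divr_ge0// invr_ge0 ltW// phi_ratio_gt0.
  rewrite ifT//; apply/pnatP => // p pp pr.
  rewrite inE/= mem_filter mem_index_iota pp prime_gt0//= ltnS.
  rewrite (leq_trans (dvdn_leq _ pr))// andbT; apply/negP => pN.
  have : (p %| gcdn r N)%N by rewrite dvdn_gcd pr.
  by rewrite (eqP rN) dvdn1 => /eqP p1; rewrite p1 in pp.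
have aps : all prime ps by apply/allP => p; rewrite mem_filter => /andP[/andP[]].
apply: le_trans (smooth_sum_le _ _ aps) _; first exact/filter_uniq/iota_uniq.
rewrite big_split/= mulrC -!mulrA; apply: ler_pM.
- rewrite big_seq prodr_ge0// => p /(allP aps) pp.
  by rewrite addr_ge0// invr_ge0 mulr_ge0// subr_ge0 ler1n prime_gt0.
- rewrite big_seq prodr_ge0// => p /(allP aps) pp.
  by rewrite invr_ge0 ltW// prime_factor_gt0.
- apply: (@le_trans _ _ (\prod_(p <- ps) expR ((p%:R * (p%:R - 1))^-1))).
    rewrite big_seq [leRHS]big_seq; apply: ler_prod => p /(allP aps) pp.
    rewrite expR_ge1Dx andbT addr_ge0// invr_ge0 mulr_ge0// subr_ge0 ler1n prime_gt0//.
  rewrite -expR_sum ler_expR; apply: le_trans (@sum_inv_mul_pred_le R n).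
  rewrite big_filter big_mkcond [leRHS]big_mkcond; apply: ler_sum_nat => p /andP[p0 _].
  case: (prime p) => //=; case: ifP => // _.
  by rewrite invr_ge0 mulr_ge0// subr_ge0 ler1n.
- rewrite mulrA -ler_pdivrMr ?phi_ratio_upto_gt0//; apply: le_trans (HC _ n1).
  rewrite big_filter [leRHS](bigID (fun p => p %| N)%N)/= mulrC.
  by rewrite [X in _ <= X * _]prodfV lexx.
Qed.

Lemma phi_ratio_prime_power {R : realType} (p j s : nat) : prime p -> (0 < s)%N ->
  (phi_ratio (p ^ j * s))^-1 <= 2 * (phi_ratio s)^-1 :> R.
Proof.
move=> pp s0.
have h : phi_ratio s <= 2 * phi_ratio (p * s) :> R.
  rewrite phi_ratioM_prime// mulrA ler_peMl ?(ltW (phi_ratio_gt0 _))//=.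
  have p2 : (p%:R)^-1 <= 2^-1 :> R by rewrite lef_pV2 ?posrE ?ltr0n ?ler_nat ?prime_gt0 ?prime_gt1.
  by case: ifP => _; lra.
suff : phi_ratio s <= 2 * phi_ratio (p ^ j * s) :> R.
  by move=> hs; rewrite ler_pdivlMr ?phi_ratio_gt0// mulrC ler_pdivrMr ?phi_ratio_gt0.
case: j => [|j]; first by rewrite expn0 mul1n ler_peMl ?(ltW (phi_ratio_gt0 _))// ler1n.
apply: le_trans h _; rewrite ler_pM2l// le_eqVlt; apply/orP; left; apply/eqP.
elim: j => [|j IH]; first by rewrite expn1.
rewrite IH [in RHS]expnS -[in RHS]mulnA [RHS]phi_ratioM_prime ?muln_gt0 ?expn_gt0 ?(prime_gt0 pp)//.
by rewrite ifT ?mul1r// expnS -mulnA dvdn_mulr.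
Qed.

(* The weight [ln r + ln (n / r) = ln n] turns the logarithmic average into the
   plain one, as in the Hall-Tenenbaum bound for multiplicative functions. *)
Lemma coprime_sum_le {R : realType} : exists2 C : R, 0 < C &
  forall N n, (1 < n)%N ->
  \sum_(1 <= r < n.+1 | coprime r N) (phi_ratio r)^-1 <=
  C * n%:R * phi_ratio_upto n N.
Proof.
have [C C0 HC] := @coprime_sum_inv_le R.
exists (13 * C) => [|N n n1]; first by rewrite mulr_gt0.
have n0 : (0 < n)%N by lia.
have lnn : 0 < ln (n%:R : R) by rewrite ln_gt0// ltr1n.
pose f r : R := if coprime r N then (phi_ratio r)^-1 else 0.
have f0 r : 0 <= f r by rewrite /f; case: ifP => // _; rewrite invr_ge0 ltW// phi_ratio_gt0.
pose L : R := \sum_(1 <= r < n.+1) f r / r%:R.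
suff H : (\sum_(1 <= r < n.+1) f r) * ln n%:R <= 13 * (n%:R * L).
  rewrite big_mkcond/= -(ler_pM2r lnn); apply: le_trans H _.
  rewrite -!mulrA ler_pM2l// mulrCA; have := HC N n n1.
  rewrite big_mkcond/= (_ : \sum_(1 <= i < n.+1) _ = L); last first.
    by apply: eq_bigr => r _; rewrite /f; case: ifP => //; rewrite mul0r.
  move=> h; rewrite ler_pM2l ?ltr0n//; apply: le_trans h _.
  by rewrite -mulrA [ln _ * _]mulrC.
(* Expand [ln r] over the prime powers dividing [r] and write [r = p ^ j * s]: for fixed [s] the sum
   over [(p, j)] is [chebyshev_psi (n %/ s)]. The 12 is the 2 of [phi_ratio_prime_power] times the 6
   of [chebyshev_psi_le]. *)
have H1 : \sum_(1 <= r < n.+1) f r * ln r%:R <= 12 * (n%:R * L).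
  apply: (@le_trans _ _ (\sum_(1 <= p < n.+1 | prime p) \sum_(1 <= j < n.+1)
      ln p%:R * \sum_(1 <= s < n.+1 | (s <= n %/ p ^ j)%N) 2 * f s)).
    rewrite (_ : \sum_(1 <= r < n.+1) f r * ln r%:R =
      \sum_(1 <= p < n.+1 | prime p) \sum_(1 <= j < n.+1)
      ln p%:R * \sum_(1 <= r < n.+1 | (p ^ j %| r)%N) f r); last first.
      transitivity (\sum_(1 <= r < n.+1) \sum_(1 <= p < n.+1 | prime p) \sum_(1 <= j < n.+1)
         ln p%:R * (if (p ^ j %| r)%N then f r else 0)).
        apply: eq_big_nat => r rn; rewrite (ln_prime_powers rn)// mulr_sumr.
        apply: eq_bigr => p _; rewrite mulr_sumr big_mkcond; apply: eq_bigr => j _.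
        by case: ifP => _; rewrite ?mulr0// mulrC.
      rewrite exchange_big/=; apply: eq_bigr => p _; rewrite exchange_big/=.
      by apply: eq_bigr => j _; rewrite [in RHS]big_mkcond mulr_sumr.
    apply: ler_sum => p pp; apply: ler_sum => j _; rewrite ler_wpM2l ?ln_nat_ge0//.
    rewrite sum_multiples ?expn_gt0 ?prime_gt0//.
    rewrite [leRHS](@big_cat_nat _ _ _ (n %/ p ^ j).+1 1 n.+1)//= ?ltnS ?leq_div//.
    rewrite -[leLHS]addr0; apply: lerD; last by apply: sumr_ge0 => s _; rewrite mulr_ge0.
    rewrite [leRHS]big_mkcond; apply: ler_sum_nat => s /andP[s0 sn].
    rewrite -ltnS sn /f coprimeMl; case: (coprime s N); rewrite ?andbF ?mulr0//= andbT.
    by case: ifP => _; rewrite ?phi_ratio_prime_power// mulr_ge0// invr_ge0 ltW// phi_ratio_gt0.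
  rewrite (_ : \sum_(_ <= p < _ | _) _ =
     \sum_(1 <= s < n.+1) 2 * f s * chebyshev_psi (n %/ s)); last first.
    transitivity (\sum_(1 <= s < n.+1) \sum_(1 <= p < n.+1 | prime p) \sum_(1 <= j < n.+1)
         (if (s <= n %/ p ^ j)%N then 2 * f s * ln p%:R else 0)).
      rewrite [RHS]exchange_big/=; apply: eq_bigr => p _; rewrite [RHS]exchange_big/=.
      apply: eq_bigr => j _; rewrite -big_mkcond/= mulr_sumr; apply: eq_bigr => s _; exact: mulrC.
    apply: eq_big_nat => s /andP[s0 sn]; rewrite (chebyshev_psi_widen (leq_div n s)) mulr_sumr.
    apply: eq_bigr => p pp; rewrite mulr_sumr -big_mkcond/=; apply: eq_bigl => j.
    by rewrite leq_divRL ?expn_gt0 ?prime_gt0// leq_divRL// mulnC.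
  rewrite !mulr_sumr; apply: ler_sum_nat => s /andP[s0 sn].
  rewrite (_ : 12 * _ = 2 * f s * (6 * (n%:R / s%:R))); last by ring.
  rewrite ler_wpM2l ?mulr_ge0//; apply: le_trans (chebyshev_psi_le _) _; rewrite ler_pM2l//.
  by rewrite ler_pdivlMr ?ltr0n// -natrM ler_nat leq_trunc_div.
rewrite (_ : 13 = 12 + 1 :> R); last by ring.
rewrite mulrDl mul1r; apply: (@le_trans _ _
   (\sum_(1 <= r < n.+1) f r * ln r%:R + \sum_(1 <= r < n.+1) f r * (n%:R / r%:R))).
  rewrite mulr_suml -big_split/=; apply: ler_sum_nat => r /andP[r0 rn].
  rewrite -mulrDr ler_wpM2l//.
  have -> : ln (n%:R : R) = ln r%:R + ln (n%:R / r%:R).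
    by rewrite ln_div ?posrE ?ltr0n// addrC subrK.
  by rewrite lerD2l ltW// ln_sublinear// divr_gt0 ?ltr0n.
apply: lerD => //; rewrite mulr_sumr; apply: ler_sum => r _.
by rewrite le_eqVlt; apply/orP; left; apply/eqP; ring.
Qed.

Lemma sum_pow2_le {R : realType} (K : nat) (y : R) : 0 <= y ->
  \sum_(0 <= k < K | 2 ^+ k <= y) 2 ^+ k <= 2 * y.
Proof.
move=> y0; elim: K => [|K IH]; first by rewrite big_geq// mulr_ge0.
rewrite big_mkcond big_nat_recr//= -big_mkcond/=; case: ifPn => Ky; last by rewrite addr0.
have : \sum_(0 <= k < K | 2 ^+ k <= y) 2 ^+ k <= 2 ^+ K :> R.
  elim: (K) => [|k IHk]; first by rewrite big_geq.
  rewrite big_mkcond big_nat_recr//= -big_mkcond/= exprS.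
  have : 0 <= 2 ^+ k :> R by rewrite exprn_ge0.
  case: ifP => _; lra.
lra.
Qed.

(** The weight [(phi_ratio r)^-1] is the loss, in counting the pairs with difference [r], at the
    primes dividing both [g] and [r]. *)
Definition coprime_sum {R : realType} (N : nat) (x : R) : R :=
  \sum_(1 <= r < (Num.truncn x).+1 | coprime r N) (phi_ratio r)^-1.

(* On the scales where [D / 2^k] is below [2^K] the inner sums are not small one by
   one, but exchanging the sums over [k] and [r] turns their total into a
   logarithmic sum, which is; this averaging replaces a sieve. *)
Lemma coprime_sum_average {R : realType} (A : nat) : exists2 C : R, 0 < C &
  forall K N (D : R), (0 < K)%N -> (0 < N < 2 ^ (2 * 2 ^ (A * K)))%N -> 0 < D ->
  \sum_(0 <= k < K) coprime_sum N (D / 2 ^+ k) / (D / 2 ^+ k) <= C * K%:R * phi_ratio N.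
Proof.
have [C6 C60 HC6] := @phi_ratio_upto_le R A.
have [C7 C70 HC7] := @coprime_sum_inv_le R.
have [C8 C80 HC8] := @coprime_sum_le R.
exists ((C8 + 2 * C7) * C6) => [|K N D K0 HN D0].
  by rewrite mulr_gt0// addr_gt0// mulr_gt0.
set Phi : R := phi_ratio_upto (2 ^ K) N.
have P0 : 0 < Phi by exact: phi_ratio_upto_gt0.
have K1 : (1 < 2 ^ K)%N by rewrite -{1}(expn0 2) ltn_exp2l.
have w0 r : 0 <= (phi_ratio r)^-1 :> R by rewrite invr_ge0 ltW// phi_ratio_gt0.
pose g k : R := \sum_(1 <= r < (2 ^ K).+1 | coprime r N)
   if 2 ^+ k <= D / r%:R then (phi_ratio r)^-1 * (2 ^+ k / D) else 0.
have p2 k : 0 < 2 ^+ k :> R by rewrite exprn_gt0.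
have g0 k : 0 <= g k.
  apply: sumr_ge0 => r _; case: ifP => // _; rewrite mulr_ge0// divr_ge0//; exact: ltW.
apply: (@le_trans _ _ (\sum_(0 <= k < K) (C8 * Phi + g k))).
  apply: ler_sum => k _; set x := D / 2 ^+ k.
  have x0 : 0 < x by rewrite divr_gt0.
  (* When the range of [r] reaches [2^K], all primes up to [2^K] have acted and [coprime_sum_le]
     suffices; the shorter ranges go into [g k]. *)
  have [Kx|xK] := leP (2 ^+ K) x.
    rewrite -[leLHS]addr0; apply: lerD => //.
    set n := Num.truncn x.
    have Kn : (2 ^ K <= n)%N by rewrite /n truncn_ge_nat ?natrX// ltW.
    have n1 := leq_trans K1 Kn.
    rewrite ler_pdivrMr//; apply: le_trans (HC8 N n n1) _.
    rewrite mulrAC; apply: ler_pM; rewrite ?mulr_ge0 ?(ltW C80) ?(ltW (phi_ratio_upto_gt0 _ _))//.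
      by rewrite ler_pM2l// phi_ratio_upto_anti.
    by rewrite truncn_le// ltW.
  rewrite -[leLHS]add0r; apply: lerD; first by rewrite mulr_ge0// ltW.
  rewrite /coprime_sum mulr_suml.
  have nK : (Num.truncn x <= 2 ^ K)%N by rewrite truncn_le_nat -natr1 natrX (lt_trans xK)// ltrDl.
  rewrite /g [leRHS](@big_cat_nat _ _ _ (Num.truncn x).+1 1 (2 ^ K).+1)//=.
  rewrite -[leLHS]addr0; apply: lerD; last first.
    by apply: sumr_ge0 => r _; case: ifP => // _; rewrite mulr_ge0// divr_ge0// ltW.
  rewrite big_mkcond [leRHS]big_mkcond; apply: ler_sum_nat => r /andP[r0 rn].
  case: ifP => // _; rewrite ifT ?invf_div//.
  rewrite ler_pdivlMr ?ltr0n// mulrC -ler_pdivlMr// -truncn_ge_nat// ltW//.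
rewrite big_split/= sumr_const_nat subn0 -mulr_natl.
have : \sum_(0 <= k < K) g k <= 2 * C7 * K%:R * Phi.
  rewrite exchange_big/=.
  apply: (@le_trans _ _ (\sum_(1 <= r < (2 ^ K).+1 | coprime r N) 2 * ((phi_ratio r)^-1 / r%:R))).
    rewrite big_mkcond [leRHS]big_mkcond; apply: ler_sum_nat => r /andP[r0 rn].
    case: ifP => // _; have rR : 0 < r%:R :> R by rewrite ltr0n.
    have := @sum_pow2_le R K (D / r%:R) (ltW (divr_gt0 D0 rR)).
    rewrite -big_mkcond/= -mulr_sumr -mulr_suml => h.
    apply: (@le_trans _ _ ((phi_ratio r)^-1 * (2 * (D / r%:R) / D))).
      by rewrite ler_wpM2l// ler_wpM2r// invr_ge0 ltW.
    rewrite le_eqVlt; apply/orP; left; apply/eqP; field.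
    by rewrite !gt_eqF// phi_ratio_gt0.
  rewrite -mulr_sumr -!mulrA ler_pM2l//; apply: le_trans (HC7 _ _ K1) _.
  rewrite -!mulrA ler_pM2l// ler_pM2r// natrX lnXn// ler_wMn2r//.
  exact: ln2_le1.
have : Phi <= C6 * phi_ratio N by exact: HC6.
move=> h1 h2; apply: (@le_trans _ _ ((C8 + 2 * C7) * K%:R * Phi)); first by nra.
have c0 : 0 <= (C8 + 2 * C7) * K%:R by rewrite mulr_ge0// addr_ge0// ?mulr_ge0// ltW.
rewrite [leRHS](_ : _ = (C8 + 2 * C7) * K%:R * (C6 * phi_ratio N)); last by ring.
by rewrite ler_wpM2l.
Qed.

(** * Close pairs of reduced fractions *)

Lemma perm_affine_mod (p q t : nat) : (0 < p)%N -> coprime p q ->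
  perm_eq [seq (t + q * i) %% p | i <- iota 0 p]%N (iota 0 p).
Proof.
move=> p0 pq.
have U : uniq [seq (t + q * i) %% p | i <- iota 0 p]%N.
  rewrite map_inj_in_uniq ?iota_uniq// => i j; rewrite !mem_iota /= !add0n => ip jp.
  wlog ij : i j ip jp / (i <= j)%N.
    by move=> H; case/orP: (leq_total i j) => ij e; [exact: H | apply/esym/H].
  move/eqP; rewrite eq_sym eqn_modDl eqn_mod_dvd ?leq_mul2l ?ij ?orbT// -mulnBr.
  rewrite Gauss_dvdr// => pd; apply/eqP; rewrite eqn_leq ij/= -subn_eq0.
  by apply: contraLR pd; rewrite -lt0n => ji; rewrite gtnNdvd//; lia.
have S : {subset [seq (t + q * i) %% p | i <- iota 0 p]%N <= iota 0 p}.
  by move=> _ /mapP[i _ ->]; rewrite mem_iota/= add0n ltn_mod.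
apply: uniq_perm; rewrite ?iota_uniq//.
by have [] := uniq_min_size U S; rewrite ?size_map ?size_iota.
Qed.

Lemma periodicM (T : Type) (h : nat -> T) (p : nat) :
  (forall t, h (t + p)%N = h t) -> forall t k, h (t + p * k)%N = h t.
Proof.
by move=> hp t; elim=> [|k IH]; rewrite ?muln0 ?addn0// mulnS addnCA addnC hp.
Qed.

Lemma periodic_mod (T : Type) (h : nat -> T) (p : nat) :
  (forall t, h (t + p)%N = h t) -> forall t, h (t %% p)%N = h t.
Proof. by move=> hp t; rewrite {2}(divn_eq t p) addnC mulnC periodicM. Qed.

Lemma sum_affine_periodic (p q t : nat) (h : nat -> nat) : (0 < p)%N -> coprime p q ->
  (forall t, h (t + p) = h t)%N ->
  (\sum_(0 <= i < p) h (t + q * i) = \sum_(0 <= i < p) h i)%N.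
Proof.
move=> p0 pq hp; rewrite /index_iota subn0.
rewrite -[RHS](perm_big _ (perm_affine_mod t p0 pq))/= big_map.
by apply: eq_bigr => i _; rewrite periodic_mod.
Qed.

Lemma sum_shift_periodic (g c : nat) (h : nat -> nat) : (forall t, h (t + g) = h t)%N ->
  (\sum_(0 <= t < g) h (t + c) = \sum_(0 <= t < g) h t)%N.
Proof.
move=> hg; elim: c => [|c IH]; first by apply: eq_bigr => t _; rewrite addn0.
rewrite -IH; case: g hg {IH} => [|g] hg; first by rewrite !big_geq.
rewrite big_nat_recr//= [RHS]big_nat_recl//= addnC; congr (_ + _)%N.
  by rewrite add0n addnS -addSn addnC hg.
by apply: eq_bigr => t _; rewrite addSnnS.
Qed.

(* Independence of the conditions at distinct primes: shifting [t] by multiples of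
   [Q], the product of the other primes, preserves the other conditions and
   permutes the residue classes modulo [p]. *)
Lemma count_avoid_le {R : realType} (g : nat) (ps : seq nat) (P : nat -> pred nat)
    (rho : nat -> R) : uniq ps -> all prime ps -> all (fun p => p %| g)%N ps ->
  (forall p t, P p (t + p)%N = P p t) -> (forall p, 0 <= rho p) ->
  (forall p, p \in ps -> (\sum_(0 <= u < p) P p u)%N%:R <= rho p * p%:R) ->
  (\sum_(0 <= t < g) all (P^~ t) ps)%N%:R <= g%:R * \prod_(p <- ps) rho p.
Proof.
move=> + + + Pper rho0; elim: ps => [|p ps IH] /=.
  by rewrite big_nil mulr1 sum_nat_const_nat subn0 muln1.
move=> /andP[pps ups] /andP[pp aps] /andP[pg ag] HP.
have p0 : 0 < p%:R :> R by rewrite ltr0n prime_gt0.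
pose h t := all (P^~ t) ps; pose Q := (\prod_(q <- ps) q)%N.
have pQ : coprime p Q.
  rewrite /Q; elim: (ps) pps aps => [|q s IHs]; first by rewrite big_nil coprimen1.
  rewrite inE negb_or big_cons => /andP[pq ps'] /= /andP[qq aps'].
  by rewrite coprimeMr prime_coprime// dvdn_prime2// pq IHs.
have hper d t : (forall q, q \in ps -> (q %| d)%N) -> h (t + d)%N = h t.
  move=> Hd; apply: eq_in_all => q qps.
  by have /dvdnP[k ->] := Hd q qps; rewrite mulnC (periodicM (Pper q)).
have hQ i t : h (t + Q * i)%N = h t.
  by apply: hper => q qps; rewrite dvdn_mulr// /Q (big_rem q)//= dvdn_mulr.
pose F t := (P p t && h t : nat).
have Fg t : F (t + g)%N = F t.
  rewrite /F hper; last by move=> q /(allP ag).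
  by have /dvdnP[k ->] := pg; rewrite mulnC (periodicM (Pper p)).
have e : (p * \sum_(0 <= t < g) F t = (\sum_(0 <= t < g) h t) * \sum_(0 <= u < p) P p u)%N.
  rewrite -[p in LHS]subn0 -sum_nat_const_nat.
  rewrite (eq_bigr (fun i => \sum_(0 <= t < g) (h t * P p (t + Q * i)))%N); last first.
    move=> i _; rewrite -(@sum_shift_periodic g (Q * i))//.
    by apply: eq_bigr => t _; rewrite /F hQ andbC mulnb.
  rewrite exchange_big/= big_distrl/=; apply: eq_bigr => t _.
  by rewrite -big_distrr/= (@sum_affine_periodic p Q t (fun u => P p u : nat)) ?prime_gt0// => s;
    rewrite Pper.
rewrite big_cons -(ler_pM2l p0) -natrM e natrM.
rewrite [leRHS](_ : _ = (g%:R * \prod_(q <- ps) rho q) * (rho p * p%:R)); last by ring.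
rewrite ler_pM ?HP ?mem_head//; apply: IH => // q qps.
by apply: HP; rewrite inE qps orbT.
Qed.

(* Density of the [t] modulo [g] with [a0 + u t] and [b0 + v t] both prime to [g],
   for [N = u v] and generic [a0], [b0]. *)
Definition gcd_ratio {R : realType} (g N : nat) : R :=
  \prod_(p <- primes g) ((1 - p%:R^-1) * (if (p %| N)%N then 1 else 1 - p%:R^-1)).

Lemma gcd_ratio_ge0 {R : realType} (g N : nat) : 0 <= gcd_ratio g N :> R.
Proof.
rewrite /gcd_ratio big_seq prodr_ge0// => p; rewrite mem_primes => /andP[pp _].
by have := @prime_factor_gt0 R p pp => h; rewrite mulr_ge0 ?ltW//; case: ifP => // _; exact: ltW.
Qed.

(** Prime by prime the two sides agree, since no prime divides both [u] and [v]. This recombines the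
    local densities of the count into the expected product for [m = g u] and [n = g v]. *)
Lemma gcd_ratioM_le {R : realType} (g u v : nat) : (0 < g)%N -> (0 < u)%N -> (0 < v)%N ->
  coprime u v ->
  gcd_ratio g (u * v) * phi_ratio (u * v) <= phi_ratio (g * u) * phi_ratio (g * v) :> R.
Proof.
move=> g0 u0 v0 uv; rewrite /gcd_ratio /phi_ratio.
pose B := (g * u * v)%N.
have B1 : (0 < g <= B)%N by rewrite g0 /B -mulnA leq_pmulr// muln_gt0 u0.
have B2 : (0 < u * v <= B)%N by rewrite muln_gt0 u0 v0 /B -mulnA leq_pmull.
have B3 : (0 < g * u <= B)%N by rewrite muln_gt0 g0 u0 /B leq_pmulr.
have B4 : (0 < g * v <= B)%N by rewrite muln_gt0 g0 v0 /B mulnAC leq_pmulr.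
rewrite (big_primes _ B1) (big_primes _ B2) (big_primes _ B3) (big_primes _ B4).
rewrite -!big_split/=; apply: ler_prod => p pp.
have h := @prime_factor_gt0 R p pp; rewrite !Euclid_dvdM//.
have : ~~ ((p %| u) && (p %| v))%N.
  by rewrite -dvdn_gcd (eqP uv) dvdn1; apply/eqP => p1; rewrite p1 in pp.
move: h; set x := 1 - _; move=> x0.
case: (p %| g)%N; case: (p %| u)%N; case: (p %| v)%N => //= _;
  rewrite ?mulr1 ?mul1r ?lexx ?andbT ?mulr_ge0 ?ltW//.
Qed.

Lemma gcd_ratio_mul_le {R : realType} (g N r : nat) : (0 < g)%N -> (0 < r)%N ->
  \prod_(p <- primes g) ((1 - p%:R^-1) * (if (p %| N * r)%N then 1 else 1 - p%:R^-1))
  <= gcd_ratio g N * (phi_ratio r)^-1 :> R.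
Proof.
move=> g0 r0; rewrite ler_pdivlMr ?phi_ratio_gt0// /gcd_ratio /phi_ratio.
have B1 : (0 < g <= g * r)%N by rewrite g0 leq_pmulr.
have B2 : (0 < r <= g * r)%N by rewrite r0 leq_pmull.
rewrite !(big_primes _ B1) (big_primes _ B2).
rewrite -!big_split/=; apply: ler_prod => p pp.
have h := @prime_factor_gt0 R p pp; have := @prime_factor_le1 R p; rewrite Euclid_dvdM//.
move: h; set x := 1 - _; move=> x0 x1.
by case: (p %| g)%N; case: (p %| N)%N; case: (p %| r)%N => //=;
  rewrite ?mulr1 ?mul1r; apply/andP; split; nra.
Qed.

Lemma dvdn_affine (p q t : nat) : (0 < p)%N -> coprime p q ->
  exists2 u, (u < p)%N & (p %| t + q * u)%N.
Proof.
move=> p0 pq; have := perm_mem (perm_affine_mod t p0 pq) 0%N.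
rewrite mem_iota /= add0n p0 => /mapP[u]; rewrite mem_iota add0n => /= up e.
by exists u => //; rewrite /dvdn -e.
Qed.

Lemma sum_avoid1_le (p u1 : nat) (P : pred nat) : (u1 < p)%N -> ~~ P u1 ->
  (\sum_(0 <= u < p) P u <= p.-1)%N.
Proof.
move=> up Pu; rewrite big_mkord (bigD1 (Ordinal up))//= (negbTE Pu) add0n.
apply: (@leq_trans (\sum_(i < p | i != Ordinal up) 1)); first by apply: leq_sum => i _; case: (P i).
by rewrite sum1_card cardC1 card_ord.
Qed.

Lemma sum_avoid2_le (p u1 u2 : nat) (P : pred nat) : (u1 < p)%N -> (u2 < p)%N ->
  u1 <> u2 -> ~~ P u1 -> ~~ P u2 -> (\sum_(0 <= u < p) P u <= p.-2)%N.
Proof.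
move=> up1 up2 u12 Pu1 Pu2; rewrite big_mkord (bigD1 (Ordinal up1))//= (negbTE Pu1) add0n.
have ne : Ordinal up2 != Ordinal up1 by apply/eqP => /(congr1 val)/= e; exact/u12/esym.
rewrite (bigD1 (Ordinal up2))//= (negbTE Pu2) add0n.
apply: (@leq_trans (\sum_(i < p | (i != Ordinal up1) && (i != Ordinal up2)) 1)).
  by apply: leq_sum => i _; case: (P i).
have e : p = (2 + \sum_(i < p | (i != Ordinal up1) && (i != Ordinal up2)) 1)%N.
  by rewrite -[LHS]card_ord -sum1_card (bigD1 (Ordinal up1))//= (bigD1 (Ordinal up2))//=.
by rewrite [X in (_ <= X.-2)%N]e.
Qed.

Lemma coprime_noprime (m n : nat) : (0 < m)%N ->
  (forall p, prime p -> (p %| m)%N -> (p %| n)%N -> False) -> coprime m n.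
Proof.
move=> m0 H; apply/negPn/negP => g1.
have g2 : (1 < gcdn m n)%N.
  by rewrite ltn_neqAle eq_sym g1 gcdn_gt0 m0.
by apply: (H _ (pdiv_prime g2)); apply: dvdn_trans (pdiv_dvd _) _; rewrite ?dvdn_gcdl ?dvdn_gcdr.
Qed.

Lemma coprime_prime_ndvd (p x m : nat) : prime p -> (p %| m)%N -> coprime x m -> ~~ (p %| x)%N.
Proof.
move=> pp pm /eqP xm; apply/negP => px.
have : (p %| gcdn x m)%N by rewrite dvdn_gcd px.
by rewrite xm dvdn1 => /eqP p1; rewrite p1 in pp.
Qed.

Lemma modn_affine (g u a s : nat) : (a + u * s = a + u * (s %% g) %[mod g * u])%N.
Proof. by rewrite {1}(divn_eq s g) mulnDr addnCA mulnCA [(u * g)%N]mulnC modnMDl. Qed.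

(** Two solutions differ by a multiple of [(u, v)], because [u] and [v] are coprime, so after fixing
    one the others are indexed by [t] modulo [g]. For each prime [p] dividing [g], coprimality
    forbids the classes of [t] with [p | a0 + u t] or [p | b0 + v t]: two distinct classes when [p]
    does not divide [u v r], and at least one in any case. *)
Lemma count_solutions_le {R : realType} (g u v r : nat) : (0 < g)%N -> (0 < u)%N -> (0 < v)%N ->
  coprime u v -> (0 < r)%N ->
  (\sum_(a < g * u) \sum_(b < g * v)
     [&& coprime a (g * u), coprime b (g * v) & a * v == b * u + r])%N%:R
  <= (if coprime r (u * v) then g%:R * gcd_ratio g (u * v) * (phi_ratio r)^-1 else 0) :> R.
Proof.
move=> g0 u0 v0 uv r0; rewrite pair_big/=.
pose C (x : 'I_(g * u) * 'I_(g * v)) :=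
  [&& coprime x.1 (g * u), coprime x.2 (g * v) & x.1 * v == x.2 * u + r]%N.
have RHS0 : 0 <= g%:R * gcd_ratio g (u * v) * (phi_ratio r)^-1 :> R.
  by rewrite !mulr_ge0// ?gcd_ratio_ge0// invr_ge0 ltW// phi_ratio_gt0.
rewrite (_ : (\sum_p _)%N = #|C|); last first.
  rewrite -sum1_card [RHS]big_mkcond; apply: eq_bigr => x _.
  by rewrite unfold_in -/(C x); case: (C x).
have [c0|] := posnP #|C|; first by rewrite c0; case: ifP.
case/card_gt0P => -[a0 b0]; rewrite unfold_in => /and3P[/= ca0 cb0 /eqP e0].
have rco : coprime r (u * v).
  apply: coprime_noprime r0 _ => p pp pr; rewrite Euclid_dvdM// => /orP[pu|pv].
    have : (p %| a0 * v)%N by rewrite e0 dvdn_add// dvdn_mull.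
    rewrite Euclid_dvdM// => /orP[pa|pv].
      by have := coprime_prime_ndvd pp (dvdn_mull g pu) ca0; rewrite pa.
    by have := coprime_prime_ndvd pp pv uv; rewrite pu.
  have : (p %| b0 * u)%N by rewrite -(dvdn_addl _ pr) -e0 dvdn_mull.
  rewrite Euclid_dvdM// => /orP[pb|pu].
    by have := coprime_prime_ndvd pp (dvdn_mull g pv) cb0; rewrite pb.
  by have := coprime_prime_ndvd pp pv uv; rewrite pu.
rewrite rco.
(* Adding [g * u] first keeps the natural subtraction exact and changes nothing modulo [g * u]. *)
pose s (x : 'I_(g * u) * 'I_(g * v)) := ((x.1 + g * u - a0) %/ u)%N.
have sE x : C x -> (x.1 + g * u = a0 + u * s x /\ x.2 + g * v = b0 + v * s x)%N.
  move=> /and3P[_ _ /eqP e]; have := ltn_ord a0; have := ltn_ord b0 => lb la.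
  set X := (x.1 + g * u - a0)%N; pose Y := (x.2 + g * v - b0)%N.
  have hX : (X + a0 = x.1 + g * u)%N by rewrite /X subnK// (leq_trans (ltnW la))// leq_addl.
  have hY : (Y + b0 = x.2 + g * v)%N by rewrite /Y subnK// (leq_trans (ltnW lb))// leq_addl.
  have XY : (X * v = Y * u)%N.
    have := congr1 (muln^~ v) hX; have := congr1 (muln^~ u) hY.
    by rewrite !mulnDl e e0 -!mulnA [(v * u)%N]mulnC; clear; lia.
  have uX : (u %| X)%N by rewrite -(Gauss_dvdl _ uv) XY dvdn_mull.
  have XE : (X = u * s x)%N by rewrite mulnC divnK.
  split; first by rewrite -hX XE addnC.
  rewrite -hY addnC; congr (_ + _)%N; apply/eqP; rewrite -(eqn_pmul2r u0) -XY XE.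
  by rewrite mulnC mulnA mulnAC.
have s1 x : C x -> x.1 = ((a0 + u * (s x %% g)) %% (g * u))%N :> nat.
  by move=> /sE[e _]; rewrite -modn_affine -e modnDr modn_small.
have s2 x : C x -> x.2 = ((b0 + v * (s x %% g)) %% (g * v))%N :> nat.
  by move=> /sE[_ e]; rewrite -modn_affine -e modnDr modn_small.
pose f x := Ordinal (ltn_pmod (s x) g0).
have finj : {in C &, injective f}.
  move=> x y xC yC /(congr1 val)/= e.
  have e1 : x.1 = y.1 by apply/val_inj; rewrite /= s1// s1// e.
  have e2 : x.2 = y.2 by apply/val_inj; rewrite /= s2// s2// e.
  by rewrite (surjective_pairing x) (surjective_pairing y) e1 e2.
pose P p t := ~~ (p %| a0 + u * t)%N && ~~ (p %| b0 + v * t)%N.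
have CP : (#|C| <= \sum_(0 <= t < g) all (P^~ t) (primes g))%N.
  rewrite -(card_in_image finj) big_mkord.
  rewrite (_ : (\sum_(_ < _) _)%N = #|[pred t : 'I_g | all (P^~ t) (primes g)]|); last first.
    by rewrite -sum1_card [RHS]big_mkcond; apply: eq_bigr => x _; rewrite inE; case: (all _ _).
  apply: subset_leq_card; apply/fintype.subsetP => y /mapP[x]; rewrite mem_enum => xC ->{y}; rewrite inE.
  apply/allP => p; rewrite mem_primes => /and3P[pp _ pg] /=.
  have [cx1 cx2 _] := and3P xC.
  apply/andP; split.
    have := coprime_prime_ndvd pp (dvdn_mulr u pg) cx1.
    by rewrite s1// /dvdn modn_dvdm// dvdn_mulr.
  have := coprime_prime_ndvd pp (dvdn_mulr v pg) cx2.
  by rewrite s2// /dvdn modn_dvdm// dvdn_mulr.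
pose rho p : R := (1 - p%:R^-1) * (if (p %| u * v * r)%N then 1 else 1 - p%:R^-1).
apply: (@le_trans _ _ (g%:R * \prod_(p <- primes g) rho p)); last first.
  by rewrite -mulrA ler_wpM2l// gcd_ratio_mul_le.
apply: (@le_trans _ _ (\sum_(0 <= t < g) all (P^~ t) (primes g))%N%:R); first by rewrite ler_nat.
have f0 p : 0 <= 1 - p%:R^-1 :> R.
  by case: p => [|p]; rewrite ?invr0 ?subr0// subr_ge0 invf_le1 ?ler1n.
apply: count_avoid_le.
- exact: primes_uniq.
- by apply/allP => p; rewrite mem_primes => /and3P[].
- by apply/allP => p; rewrite mem_primes => /and3P[].
- move=> p t; rewrite /P !mulnDr !addnA; congr (~~ _ && ~~ _).
    by rewrite [LHS]dvdn_addl// dvdn_mull.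
  by rewrite [LHS]dvdn_addl// dvdn_mull.
- by move=> p; rewrite mulr_ge0//; case: ifP.
move=> p; rewrite mem_primes => /and3P[pp _ pg].
have p0 := prime_gt0 pp; have p0R : 0 < p%:R :> R by rewrite ltr0n.
have Pu : ~~ (p %| u)%N -> exists2 i, (i < p)%N & (p %| a0 + u * i)%N.
  by rewrite -prime_coprime// => pu; exact: dvdn_affine.
have Pv : ~~ (p %| v)%N -> exists2 i, (i < p)%N & (p %| b0 + v * i)%N.
  by rewrite -prime_coprime// => pv; exact: dvdn_affine.
have H1 : (\sum_(0 <= i < p) P p i <= p.-1)%N.
  case: (boolP (p %| u)%N) => pu.
    have [|i ip pi] := Pv.
      by apply: coprime_prime_ndvd pp pu _; rewrite coprime_sym.
    by apply: (@sum_avoid1_le _ i) => //; rewrite /P pi andbF.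
  have [//|i ip pi] := Pu.
  by apply: (@sum_avoid1_le _ i) => //; rewrite /P pi.
rewrite /rho; case: ifPn => [_|].
  rewrite mulr1 mulrBl mul1r mulVf ?gt_eqF// lerBrDr natr1 ler_nat.
  by rewrite (leq_ltn_trans H1)// prednK.
rewrite Euclid_dvdM// Euclid_dvdM// !negb_or => /andP[/andP[pu pv] pr].
have [//|i1 ip1 pi1] := Pu; have [//|i2 ip2 pi2] := Pv.
(* If the two forbidden classes agreed, [p] would divide [(a0 + u * i1) * v - (b0 + v * i1) * u],
   which is [r]. *)
have i12 : i1 <> i2.
  move=> ii; rewrite -{}ii in pi2; move/negP : pr; apply.
  have : (p %| (a0 + u * i1) * v)%N by rewrite dvdn_mulr.
  have -> : ((a0 + u * i1) * v = (b0 + v * i1) * u + r)%N.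
    by rewrite !mulnDl e0; clear; lia.
  by rewrite dvdn_addr// dvdn_mulr.
have := @sum_avoid2_le p i1 i2 (P p) ip1 ip2 i12; rewrite /P pi1 pi2 /= andbF => /(_ isT isT) H2.
apply: (@le_trans _ _ (p%:R - 2)).
  by rewrite lerBrDr -natrD ler_nat; have := prime_gt1 pp; move: H2; rewrite /P; clear; lia.
have -> : (1 - p%:R^-1) * (1 - p%:R^-1) * p%:R = p%:R - 2 + p%:R^-1 :> R.
  by field; rewrite gt_eqF.
by rewrite lerDl invr_ge0.
Qed.

Lemma count_close_le {R : realType} (g u v : nat) (eta : R) : (0 < g)%N -> (0 < u)%N -> (0 < v)%N ->
  coprime u v -> u != v -> 0 <= eta ->
  (\sum_(a < g * u) \sum_(b < g * v)
     [&& coprime a (g * u), coprime b (g * v) &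
         (`|a%:R / (g * u)%N%:R - b%:R / (g * v)%N%:R| < eta)%R])%N%:R
  <= 2 * (g%:R * gcd_ratio g (u * v)) * coprime_sum (u * v) (eta * (g * u * v)%N%:R).
Proof.
move=> g0 u0 v0 uv uNv eta0; set D := eta * _.
(* [c1] and [c2] are the two signs of [a v - b u], whence the factor 2. *)
pose c1 (a b r : nat) := [&& coprime a (g * u), coprime b (g * v) & a * v == b * u + r]%N.
pose c2 (a b r : nat) := [&& coprime b (g * v), coprime a (g * u) & b * u == a * v + r]%N.
have D0 : 0 <= D by rewrite mulr_ge0.
have H (a b : nat) :
  ([&& coprime a (g * u), coprime b (g * v) &
         (`|a%:R / (g * u)%N%:R - b%:R / (g * v)%N%:R| < eta)%R] <=
   \sum_(1 <= r < (Num.truncn D).+1) (c1 a b r + c2 a b r))%N.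
  case: and3P => // -[ca cb hab].
  suff [r /andP[r0 rD] cr] : exists2 r, (1 <= r < (Num.truncn D).+1)%N & c1 a b r || c2 a b r.
    rewrite (big_cat_nat (n := r))//=; last exact: ltnW.
    rewrite [X in (_ + X)%N]big_ltn// addnCA (@leq_trans (c1 a b r + c2 a b r))%N ?leq_addr//.
    by case/orP: cr => ->; rewrite ?leq_addr ?leq_addl.
  (* Equality of the two reduced fractions would force [u = v = 1], so the difference [r = 0] does
     not occur. *)
  have avbu : (a * v != b * u)%N.
    apply/eqP => e; move: uNv; apply/negP/negPn.
    have u1 : u = 1%N.
      have ua : (u %| a)%N by rewrite -(Gauss_dvdl _ uv) e dvdn_mull.
      apply/eqP; rewrite -dvdn1 -(eqP ca) dvdn_gcd ua dvdn_mull//.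
    have v1 : v = 1%N.
      have vb : (v %| b)%N by rewrite -(@Gauss_dvdl v b u) 1?coprime_sym// -e dvdn_mull.
      apply/eqP; rewrite -dvdn1 -(eqP cb) dvdn_gcd vb dvdn_mull//.
    by rewrite u1 v1.
  have guv : 0 < (g * u * v)%N%:R :> R by rewrite ltr0n !muln_gt0 g0 u0.
  have key : `|(a * v)%N%:R - (b * u)%N%:R| < D.
    have -> : (a * v)%N%:R - (b * u)%N%:R =
        (a%:R / (g * u)%N%:R - b%:R / (g * v)%N%:R) * (g * u * v)%N%:R :> R.
      by rewrite !natrM; field; rewrite !pnatr_eq0 -!lt0n g0 u0 v0.
    by rewrite normrM [`|_%:R|]ger0_norm ?ltr_pM2r.
  case/orP: (leq_total (a * v) (b * u)) => le.
    exists (b * u - a * v)%N; last by rewrite /c1 /c2 cb ca subnKC// eqxx orbT.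
    rewrite subn_gt0 ltn_neqAle avbu le/= ltnS truncn_ge_nat// natrB//.
    by rewrite ltW// (le_lt_trans _ key)// -normrN opprB ler_norm.
  exists (a * v - b * u)%N; last by rewrite /c1 /c2 cb ca subnKC// eqxx.
  rewrite subn_gt0 ltn_neqAle eq_sym avbu le/= ltnS truncn_ge_nat// natrB//.
  by rewrite ltW// (le_lt_trans _ key)// ler_norm.
apply: (@le_trans _ _ (\sum_(1 <= r < (Num.truncn D).+1)
  ((\sum_(a < g * u) \sum_(b < g * v) c1 a b r)%N%:R +
   (\sum_(b < g * v) \sum_(a < g * u) c2 a b r)%N%:R))).
  rewrite (eq_bigr (fun r => (\sum_(a < g * u) \sum_(b < g * v) (c1 a b r + c2 a b r))%N%:R)); last first.
    move=> r _; rewrite -natrD; congr (_%:R).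
    rewrite [X in (_ + X)%N]exchange_big/= -big_split/=; apply: eq_bigr => a _.
    by rewrite -big_split.
  rewrite -natr_sum ler_nat [leqRHS]exchange_big/=; apply: leq_sum => a _.
  by rewrite [leqRHS]exchange_big/=; apply: leq_sum => b _; exact: H.
rewrite /coprime_sum mulr_sumr [leRHS]big_mkcond/=; apply: ler_sum_nat => r /andP[r0 _].
have := @count_solutions_le R g u v r g0 u0 v0 uv r0.
have := @count_solutions_le R g v u r g0 v0 u0; rewrite coprime_sym => /(_ uv r0).
rewrite [(v * u)%N]mulnC -/(c1 _ _ _) => h2 h1; apply: le_trans (lerD h1 h2) _.
case: ifP => _; last by rewrite addr0.
by rewrite le_eqVlt; apply/orP; left; apply/eqP; ring.
Qed.

(** * The second moment method *)

Lemma integral_sum_indic {d} {T : measurableType d} {R : realType}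
    (mu : {measure set T -> \bar R}) (I : Type) (s : seq I) (a : I -> R) (A : I -> set T) :
  (forall i, 0 <= a i) -> (forall i, measurable (A i)) ->
  (\int[mu]_x (\sum_(i <- s) a i * \1_(A i) x)%:E = \sum_(i <- s) (a i)%:E * mu (A i))%E.
Proof.
move=> a0 mA; under eq_integral do rewrite -sumEFin.
rewrite ge0_integral_sum//=; last 2 first.
- move=> i; apply/measurable_EFinP/measurable_funM => //.
- by move=> i x _; rewrite lee_fin mulr_ge0.
apply: eq_bigr => i _; under eq_integral do rewrite EFinM.
rewrite ge0_integralZl_EFin//; last exact/measurable_EFinP/measurable_indic.
by rewrite integral_indic// setIT.
Qed.

(* Integrating the pointwise inequality [2 t F - t^2 F^2 <= 1_U], where [F]
   counts the sets [A j] containing the point, and optimizing over [t]. *)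
Lemma second_moment {d} {T : measurableType d} {R : realType}
    (mu : {measure set T -> \bar R}) (J : finType) (A : J -> set T) (U : set T)
    (m : R) (s : J -> R) (v : J -> J -> R) :
  (forall j, measurable (A j)) -> measurable U -> (forall j, A j `<=` U) ->
  (mu U <= m%:E)%E -> (forall j, 0 <= s j) -> (forall j, mu (A j) = (s j)%:E) ->
  (forall i j, 0 <= v i j) -> (forall i j, (mu (A i `&` A j) <= (v i j)%:E)%E) ->
  (\sum_j s j) ^+ 2 <= m * \sum_i \sum_j v i j.
Proof.
move=> mA mU AU Um s0 As v0 Av; set S := \sum_j s j; set V := \sum_i _.
have S0 : 0 <= S by apply: sumr_ge0.
have V0 : 0 <= V by apply: sumr_ge0 => i _; apply: sumr_ge0.
have key t : 0 <= t -> 2 * t * S <= m + t ^+ 2 * V.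
  move=> t0.
  (* [None] stands for [U] with weight 1 and [Some (i, j)] for a pair intersection with weight
     [t^2], so that the right-hand side is a single weighted sum of indicators. *)
  pose B (k : option (J * J)) := if k is Some (i, j) then A i `&` A j else U.
  pose b (k : option (J * J)) : R := if k is Some _ then t ^+ 2 else 1.
  have b0 k : 0 <= b k by case: k => //= _; rewrite sqr_ge0.
  have mB k : measurable (B k) by case: k => [[i j]|]//; exact: measurableI.
  have tt0 : 0 <= 2 * t by rewrite mulr_ge0.
  pose ks := None :: [seq Some p | p <- enum {: J * J}].
  have : (\int[mu]_x (\sum_(j <- enum J) (2 * t) * \1_(A j) x)%:E <=
          \int[mu]_x (\sum_(k <- ks) b k * \1_(B k) x)%:E)%E.
    have mI (I : Type) (q : seq I) (e : I -> R) (E : I -> set T) :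
        (forall i, measurable (E i)) ->
        measurable_fun [set: T] (fun x : T => (\sum_(i <- q) e i * \1_(E i) x)%:E).
      move=> mE; apply/measurable_EFinP; apply: measurable_sum => i.
      by apply: measurable_funM => //; exact: measurable_indic.
    apply: ge0_le_integral => //.
    - by move=> x _; rewrite lee_fin sumr_ge0// => j _; rewrite mulr_ge0.
    - exact: mI.
    - exact: mI.
    move=> x _; rewrite lee_fin big_cons big_map /= mul1r.
    rewrite !big_enum/= -[X in _ <= _ + X]mulr_sumr -mulr_sumr.
    set F := \sum_(j in J) \1_(A j) x.
    have -> : \sum_(i in {: J * J}) \1_(B (Some i)) x = F ^+ 2 :> R.
      rewrite expr2 /F big_distrlr/= pair_big/=; apply: eq_bigr => -[i j] _ /=.
      by rewrite indicI.
    have F0 : 0 <= F by apply: sumr_ge0 => j _; rewrite indicE.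
    have [xU|xU] := boolP (x \in U).
      by rewrite indicE xU; have := sqr_ge0 (t * F - 1); rewrite mulr1n; nra.
    rewrite (_ : F = 0) ?mulr0 ?expr2 ?mulr0 ?addr0//.
    rewrite /F big1// => j _; rewrite indicE; case: (boolP (x \in A j)) => // xA.
    by move/negP: xU; case; rewrite inE; apply: (AU j); rewrite inE in xA.
  rewrite !integral_sum_indic// big_cons big_map/= mul1e => H.
  rewrite -lee_fin; apply: le_trans (le_trans H _).
    rewrite big_enum/= (eq_bigr (fun j => (2 * t * s j)%:E)); last by move=> j _; rewrite As.
    by rewrite sumEFin -mulr_sumr.
  rewrite EFinD; apply: leeD => //; rewrite big_enum/=.
  apply: (@le_trans _ _ (\sum_(p : J * J) (t ^+ 2 * v p.1 p.2)%:E)%E).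
    apply: lee_sum => -[i j] _ /=; by rewrite (EFinM (t ^+ 2)) lee_wpmul2l// lee_fin sqr_ge0.
  by rewrite sumEFin -mulr_sumr -(pair_big xpredT xpredT v)/= lexx.
(* The optimal [t = S / V] needs [V] nonzero; when [V = 0] a large [t] forces [S = 0]. *)
have [V1|V1] := eqVneq V 0.
  rewrite V1 mulr0; have [->|Sn] := eqVneq S 0; first by rewrite expr2 mulr0.
  have Sp : 0 < S by rewrite lt0r Sn.
  have m0 : 0 <= m by rewrite -lee_fin (le_trans _ Um).
  have := key ((m + 1) / (2 * S)); rewrite V1 mulr0 addr0 divr_ge0 ?addr_ge0 ?mulr_ge0//.
  move=> /(_ isT); have -> : 2 * ((m + 1) / (2 * S)) * S = m + 1 by field; rewrite gt_eqF.
  by rewrite gerDl ler10.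
have Vp : 0 < V by rewrite lt0r V1.
have := key (S / V); rewrite divr_ge0// => /(_ isT).
have -> : 2 * (S / V) * S = 2 * (S ^+ 2 / V) by field; rewrite gt_eqF.
have -> : (S / V) ^+ 2 * V = S ^+ 2 / V by field; rewrite gt_eqF.
by move=> h; rewrite -ler_pdivrMr//; lra.
Qed.

(** * Overlaps of intervals around reduced fractions *)

Lemma lebesgue_measure_centered {R : realType} (c r : R) : 0 <= r ->
  lebesgue_measure `]c - r, c + r[%classic = (2 * r)%:E.
Proof.
move=> r0; rewrite lebesgue_measure_itv/= lte_fin.
case: ltP => h; first by rewrite -EFinB; congr (_%:E); ring.
by congr (_%:E); lra.
Qed.

Lemma lebesgue_measure_centeredI {R : realType} (c d r s : R) : 0 <= r -> 0 <= s ->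
  (lebesgue_measure (`](c - r)%R, (c + r)%R[%classic `&` `](d - s)%R, (d + s)%R[%classic) <=
   (if `|c - d| < r + s then 2 * Num.min r s else 0)%:E)%E.
Proof.
move=> r0 s0; have mI (a b : R) : measurable (`]a, b[%classic : set (measurableTypeR R)).
  exact: measurable_itv.
case: ifPn => [_|].
  rewrite minEle; case: ifP => _.
    rewrite -(lebesgue_measure_centered c r0); apply: le_measure; rewrite ?inE//.
    exact: measurableI.
  rewrite -(lebesgue_measure_centered d s0); apply: le_measure; rewrite ?inE//.
  exact: measurableI.
rewrite -leNgt => h.
rewrite (_ : _ `&` _ = set0) ?measure0// -subset0 => x [] /=; rewrite !in_itv/=.
move=> /andP[h1 h2] /andP[h3 h4]; move: h; rewrite leNgt => /negP; apply.
rewrite ltr_norml; apply/andP; split; lra.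
Qed.

Definition overlap {R : realType} (alpha beta : R) (m n : nat) : R :=
  \sum_(a < m) \sum_(b < n)
    if [&& coprime a m, coprime b n & `|a%:R / m%:R - b%:R / n%:R| < alpha + beta]
    then 2 * Num.min alpha beta else 0.

Lemma overlap_le {R : realType} (g u v : nat) (alpha beta : R) :
  (0 < g)%N -> (0 < u)%N -> (0 < v)%N -> coprime u v -> u != v -> 0 <= alpha -> 0 <= beta ->
  overlap alpha beta (g * u) (g * v) <=
  4 * Num.min alpha beta * (g%:R * gcd_ratio g (u * v)) *
    coprime_sum (u * v) ((alpha + beta) * (g * u * v)%N%:R).
Proof.
move=> g0 u0 v0 uv uNv a0 b0.
have m0 : 0 <= Num.min alpha beta by rewrite le_min a0.
have := @count_close_le R g u v (alpha + beta) g0 u0 v0 uv uNv (addr_ge0 a0 b0).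
move/(ler_wpM2l (mulr_ge0 (ler0n R 2) m0)) => h; apply: le_trans (le_trans _ h) _.
  rewrite natr_sum mulr_sumr; apply: ler_sum => a _.
  rewrite natr_sum mulr_sumr; apply: ler_sum => b _.
  by case: ifP => _; rewrite ?mulr1 ?mulr0.
by rewrite le_eqVlt; apply/orP; left; apply/eqP; ring.
Qed.

(** The inequality [min alpha beta <= 2 alpha beta / (alpha + beta)] turns the bound at scale [k]
    into [coprime_sum] at [D / 2^k] divided by [D / 2^k], the quantity averaged in
    [coprime_sum_average]; the weight [4^k] cancels the two factors [2^-k] in [alpha beta]. *)
Lemma overlap_average {R : realType} (A : nat) : exists2 C : R, 0 < C &
  forall K m n (x y : R), (0 < K)%N -> (0 < m < 2 ^ 2 ^ (A * K))%N ->
  (0 < n < 2 ^ 2 ^ (A * K))%N -> m != n -> 0 <= x -> 0 <= y ->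
  \sum_(0 <= k < K) 4 ^+ k * overlap (x / 2 ^+ k / m%:R) (y / 2 ^+ k / n%:R) m n <=
  C * K%:R * (x * phi_ratio m) * (y * phi_ratio n).
Proof.
have [C C0 HC] := @coprime_sum_average R A.
exists (8 * C) => [|K m n x y K0 /andP[m0 mK] /andP[n0 nK] mn x0 y0]; first by rewrite mulr_gt0.
have [xy0|xy] := boolP ((x == 0) && (y == 0)).
  have [/eqP-> /eqP->] := andP xy0; rewrite !mul0r mulr0 big1// => k _.
  rewrite /overlap !mul0r minxx mulr0 big1 ?mulr0// => a _; rewrite big1// => b _.
  by case: ifP.
have [g [u [v [g0 mE nE uv]]]] : exists g u v : nat,
    [/\ (0 < g)%N, m = (g * u)%N, n = (g * v)%N & coprime u v].
  have g0 : (0 < gcdn m n)%N by rewrite gcdn_gt0 m0.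
  have mE : m = (gcdn m n * (m %/ gcdn m n))%N by rewrite mulnC divnK// dvdn_gcdl.
  have nE : n = (gcdn m n * (n %/ gcdn m n))%N by rewrite mulnC divnK// dvdn_gcdr.
  exists (gcdn m n), (m %/ gcdn m n)%N, (n %/ gcdn m n)%N; split => //.
  by rewrite /coprime -(eqn_pmul2l g0) muln1 muln_gcdr -mE -nE.
subst m n.
have u0 : (0 < u)%N by move: m0; rewrite muln_gt0 => /andP[].
have v0 : (0 < v)%N by move: n0; rewrite muln_gt0 => /andP[].
have uNv : u != v by apply: contra mn => /eqP ->.
have ulem : (u <= g * u)%N by rewrite leq_pmull.
have vlen : (v <= g * v)%N by rewrite leq_pmull.
have uvK : (0 < u * v < 2 ^ (2 * 2 ^ (A * K)))%N.
  rewrite muln_gt0 u0 v0/= mul2n -addnn expnD.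
  by apply: ltn_mul; [exact: leq_ltn_trans mK | exact: leq_ltn_trans nK].
have kap := @gcd_ratioM_le R g u v g0 u0 v0 uv.
have kap0 := @gcd_ratio_ge0 R g (u * v).
have gR : 0 < g%:R :> R by rewrite ltr0n.
have uR : 0 < u%:R :> R by rewrite ltr0n.
have vR : 0 < v%:R :> R by rewrite ltr0n.
pose D : R := x * v%:R + y * u%:R.
have D0 : 0 < D.
  rewrite lt0r addr_ge0 ?mulr_ge0// andbT paddr_eq0 ?mulr_ge0// !mulf_eq0.
  by rewrite (gt_eqF uR) (gt_eqF vR) !orbF.
apply: (@le_trans _ _ (8 * (x * y * gcd_ratio g (u * v)) *
   \sum_(0 <= k < K) coprime_sum (u * v) (D / 2 ^+ k) / (D / 2 ^+ k))); last first.
  have xyk : 0 <= 8 * (x * y * gcd_ratio g (u * v)) by rewrite !mulr_ge0.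
  apply: le_trans (ler_wpM2l xyk (HC K _ D K0 uvK D0)) _.
  rewrite [leLHS](_ : _ = 8 * C * K%:R * (x * y) *
    (gcd_ratio g (u * v) * phi_ratio (u * v))); last by ring.
  rewrite [leRHS](_ : _ = 8 * C * K%:R * (x * y) *
    (phi_ratio (g * u) * phi_ratio (g * v))); last by ring.
  by rewrite ler_wpM2l// !mulr_ge0// ltW.
rewrite mulr_sumr; apply: ler_sum => k _.
set al := x / 2 ^+ k / _; set be := y / 2 ^+ k / _.
have k0 : 0 < 2 ^+ k :> R by rewrite exprn_gt0.
have al0 : 0 <= al by rewrite !divr_ge0// ltW.
have be0 : 0 <= be by rewrite !divr_ge0// ltW.
have abD : (al + be) * (g * u * v)%N%:R = D / 2 ^+ k.
  by rewrite /al /be /D !natrM; field; rewrite !gt_eqF.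
have := @overlap_le R g u v al be g0 u0 v0 uv uNv al0 be0.
rewrite abD => h; apply: le_trans (ler_wpM2l (exprn_ge0 k (ler0n R 4)) h) _.
set T := coprime_sum _ _.
have T0 : 0 <= T by apply: sumr_ge0 => r _; rewrite invr_ge0 ltW// phi_ratio_gt0.
have ab0 : 0 < al + be.
  have : 0 < (al + be) * (g * u * v)%N%:R by rewrite abD divr_gt0.
  by rewrite pmulr_lgt0// ltr0n !muln_gt0 g0 u0.
have minle : Num.min al be <= 2 * al * be / (al + be).
  by rewrite ler_pdivlMr// minEle; case: ifP => hab; nra.
set w := al + be in ab0 minle abD *.
have E : 8 * (x * y * gcd_ratio g (u * v)) * (T / (D / 2 ^+ k)) =
   4 ^+ k * (4 * (2 * al * be / w) * (g%:R * gcd_ratio g (u * v)) * T).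
  rewrite -abD (_ : 4 = 2 * 2) ?exprMn; last by rewrite -natrM.
  rewrite /al /be !natrM; move: w ab0 {minle abD} => w w0; clearbody T.
  by field; rewrite !gt_eqF.
rewrite E ler_wpM2l ?exprn_ge0// !ler_wpM2r ?mulr_ge0// ler_pM2l//.
Qed.

(** * The second moment over a block of denominators *)

Lemma totient_phi_ratio {R : realType} (n : nat) : (0 < n)%N ->
  (totient n)%:R = n%:R * phi_ratio n :> R.
Proof.
move=> n0; rewrite totientE//.
have -> : n%:R = (\prod_(p <- primes n) p ^ logn p n)%N%:R :> R.
  by rewrite {1}(prod_prime_decomp n0) prime_decompE big_map.
rewrite !natr_prod /phi_ratio -big_split/= big_seq [RHS]big_seq; apply: eq_bigr => p pn.
have pp : prime p by move: pn; rewrite mem_primes => /andP[].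
have p0 : p%:R != 0 :> R by rewrite pnatr_eq0 -lt0n prime_gt0.
have lp : (0 < logn p n)%N by rewrite logn_gt0.
rewrite -{2}(prednK lp) expnS !natrM -subn1 natrB ?prime_gt0//.
by field.
Qed.

Lemma sum_coprime_totient {R : realType} (n : nat) (z : R) :
  \sum_(a < n) (if coprime a n then z else 0) = (totient n)%:R * z.
Proof.
rewrite totient_count_coprime big_mkord natr_sum mulr_suml; apply: eq_bigr => a _.
by rewrite coprime_sym; case: ifP; rewrite ?mul1r ?mul0r.
Qed.

(** Numerators are arbitrary integers on the real line, which makes the effect of [x |-> q x - i]
    immediate; reduction modulo 1 reappears only in [approx_setP]. *)
Definition near_fraction {R : realType} (psi : nat -> R) (n : nat) : set R :=
  [set x | exists a : int, `|n%:R * x - a%:~R| < psi n].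

Definition hits {R : realType} (psi : nat -> R) (P : set nat) : set R :=
  `[0, 1[%classic `&` \bigcup_(n in P) near_fraction psi n.

Lemma measurable_near_fraction {R : realType} (psi : nat -> R) (n : nat) : (0 < n)%N ->
  measurable (near_fraction psi n : set (measurableTypeR R)).
Proof.
move=> n0; have nR : 0 < n%:R :> R by rewrite ltr0n.
rewrite (_ : near_fraction _ _ =
  \bigcup_(a : int) `](a%:~R - psi n) / n%:R, (a%:~R + psi n) / n%:R[%classic).
  apply: countable_bigcupT_measurable => [|a]; first exact: countableP.
  exact: measurable_itv.
apply/seteqP; split => [x [a]|x [a _]]/=.
  rewrite ltr_norml => /andP[h1 h2]; exists a => //=; rewrite in_itv/=.
  rewrite ltr_pdivrMr// ltr_pdivlMr//; apply/andP; split; lra.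
rewrite in_itv/= ltr_pdivrMr// ltr_pdivlMr// => /andP[h1 h2]; exists a.
rewrite ltr_norml; apply/andP; split; lra.
Qed.

Lemma measurable_hits {R : realType} (psi : nat -> R) (P : set nat) :
  (forall n, P n -> (0 < n)%N) -> measurable (hits psi P : set (measurableTypeR R)).
Proof.
move=> P0; apply: measurableI; first exact: measurable_itv.
by apply: bigcup_measurable => n Pn; apply: measurable_near_fraction; exact: P0.
Qed.

Lemma hits_le1 {R : realType} (psi : nat -> R) (P : set nat) :
  (forall n, P n -> (0 < n)%N) -> (lebesgue_measure (hits psi P) <= 1%:E)%E.
Proof.
move=> P0; have <- : lebesgue_measure (`[0%R, 1%R[%classic : set R) = 1%:E.
  by rewrite lebesgue_measure_itv/= lte01 sube0.
apply: le_measure; rewrite ?inE; last exact: subIsetl.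
  exact: measurable_hits.
exact: measurable_itv.
Qed.

(** Distinct fractions of denominator [n] are at least [1/n >= 2 alpha] apart, so each interval
    meets only itself. *)
Lemma overlap_diag_le {R : realType} (alpha : R) (n : nat) : (0 < n)%N -> 0 <= alpha ->
  2 * alpha * n%:R <= 1 -> overlap alpha alpha n n <= 2 * alpha * (totient n)%:R.
Proof.
move=> n0 a0 an; rewrite [leRHS]mulrC -sum_coprime_totient; apply: ler_sum => a _.
have nR : 0 < n%:R :> R by rewrite ltr0n.
rewrite (bigD1 a)//= big1 ?addr0; last first.
  move=> b ba; case: ifP => // /and3P[_ _]; rewrite -mulrBl normrM normfV.
  rewrite [`|n%:R|]ger0_norm// ltr_pdivrMr// => h; exfalso.
  have : `|a%:R - b%:R| < 1 :> R by apply: lt_le_trans h _; lra.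
  have : (a < b)%N || (b < a)%N.
    by rewrite -neq_ltn eq_sym; apply: contra ba => /eqP e; apply/eqP/val_inj.
  case/orP => lt; rewrite ltr_norml => /andP[h1 h2].
    by have : a.+1%:R <= b%:R :> R; [rewrite ler_nat|rewrite -natr1; lra].
  by have : b.+1%:R <= a%:R :> R; [rewrite ler_nat|rewrite -natr1; lra].
rewrite minxx; case: ifP => [/and3P[->]//|_].
by case: ifP => // _; rewrite mulr_ge0.
Qed.

Lemma sum_ord_narrow {R : realType} (n B : nat) (F : nat -> R) : (n <= B)%N ->
  \sum_(a < B) (if (a < n)%N then F a else 0) = \sum_(a < n) F a.
Proof. by move=> nB; rewrite -big_mkcond/= -(big_ord_widen B). Qed.

Lemma sum_geometric2 {R : realType} (K : nat) : \sum_(0 <= k < K) 2 ^+ k <= 2 ^+ K :> R.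
Proof.
elim: K => [|k IH]; first by rewrite big_geq.
by rewrite big_nat_recr//= exprS; lra.
Qed.

Lemma scale_second_moment {R : realType} (psi : nat -> R) (P : pred nat) (B k : nat) (m : R) :
  (forall n, P n -> (1 < n < B)%N) -> (forall n, P n -> 0 <= psi n <= 1 / 2) ->
  (lebesgue_measure (hits psi [set n | P n]) <= m%:E)%E ->
  4 * (\sum_(n < B) (if P n then psi n * phi_ratio n else 0)) ^+ 2 <= m * (4 ^+ k *
    \sum_(n < B) \sum_(n' < B) (if P n && P n' then
      overlap (psi n / 2 ^+ k / n%:R) (psi n' / 2 ^+ k / n'%:R) n n' else 0)).
Proof.
move=> PB Ppsi Um; pose rad n : R := psi n / 2 ^+ k / n%:R.
have k0 : 0 < 2 ^+ k :> R by rewrite exprn_gt0.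
have P0 n : P n -> 0 < n%:R :> R by move/PB => /andP[n1 _]; rewrite ltr0n; lia.
have rad0 n : P n -> 0 <= rad n.
  by move=> Pn; have /andP[p0 _] := Ppsi _ Pn; rewrite !divr_ge0// ltW// P0.
pose vd (n a : nat) := [&& P n, (a < n)%N & coprime a n].
(* Radius 0 makes the interval empty, so all pairs [(n, a)] in one finite type can serve as
   indices. *)
pose rho (j : 'I_B * 'I_B) : R := if vd j.1 j.2 then rad j.1 else 0.
pose ctr (j : 'I_B * 'I_B) : R := (j.2)%:R / (j.1)%:R.
have rho0 j : 0 <= rho j by rewrite /rho; case: ifP => // /and3P[/rad0].
pose v i j : R := if `|ctr i - ctr j| < rho i + rho j then 2 * Num.min (rho i) (rho j) else 0.
have v0 i j : 0 <= v i j.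
  by rewrite /v; case: ifP => // _; rewrite mulr_ge0// le_min !rho0.
have := @second_moment _ _ _ (@lebesgue_measure R) ('I_B * 'I_B)%type
  (fun j => `]ctr j - rho j, ctr j + rho j[%classic) (hits psi [set n | P n]) m
  (fun j => 2 * rho j) v.
have -> : \sum_j 2 * rho j = 2 / 2 ^+ k *
    (\sum_(n < B) (if P n then psi n * phi_ratio n else 0)).
  rewrite -(pair_big xpredT xpredT (fun a b => 2 * rho (a, b)))/= mulr_sumr.
  apply: eq_bigr => n _; case: (boolP (P n)) => Pn; last first.
    by rewrite mulr0 big1// => a _; rewrite /rho/= /vd (negbTE Pn) mulr0.
  transitivity (\sum_(a < B) if (a < n)%N then (if coprime a n then 2 * rad n else 0) else 0).
    by apply: eq_bigr => a _; rewrite /rho /vd/= Pn/=; case: (a < n)%N; case: (coprime a n);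
      rewrite /= ?mulr0.
  rewrite (@sum_ord_narrow R n B (fun a => if coprime a n then 2 * rad n else 0)); last exact: ltnW.
  rewrite sum_coprime_totient totient_phi_ratio; last by rewrite -(ltr0n R) P0.
  by rewrite /rad; field; rewrite !gt_eqF// P0.
have vr (i j : 'I_B * 'I_B) : ~~ vd j.1 j.2 -> v i j = 0.
  by move=> /negbTE h; rewrite /v /rho h (min_idPr _) ?rho0// mulr0; case: ifP.
have vl (i j : 'I_B * 'I_B) : ~~ vd i.1 i.2 -> v i j = 0.
  by move=> /negbTE h; rewrite /v /rho h (min_idPl _) ?rho0// mulr0; case: ifP.
have VE : \sum_i \sum_j v i j =
    \sum_(n < B) \sum_(n' < B) (if P n && P n' then
      overlap (psi n / 2 ^+ k / n%:R) (psi n' / 2 ^+ k / n'%:R) n n' else 0).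
  rewrite -(pair_big xpredT xpredT (fun n a => \sum_j v (n, a) j))/=.
  apply: eq_bigr => n _.
  transitivity (\sum_(a < B) \sum_(n' < B) \sum_(b < B) v (n, a) (n', b)).
    by apply: eq_bigr => a _; rewrite [RHS]pair_big/=; apply: eq_bigr => -[].
  rewrite exchange_big/=; apply: eq_bigr => n' _.
  have [/andP[Pn Pn']|nP] := boolP (P n && P n'); last first.
    rewrite big1// => a _; rewrite big1// => b _.
    move: nP; rewrite negb_and => /orP[] /negbTE nP.
      by rewrite vl// /vd/= nP.
    by rewrite vr// /vd/= nP.
  pose G (a b : nat) : R :=
    if [&& coprime a n, coprime b n' & `|a%:R / n%:R - b%:R / n'%:R| < rad n + rad n']
    then 2 * Num.min (rad n) (rad n') else 0.
  transitivity (\sum_(a < B) (if (a < n)%N then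
      \sum_(b < B) (if (b < n')%N then G a b else 0) else 0)); last first.
    rewrite (@sum_ord_narrow R n B (fun a => \sum_(b < B) (if (b < n')%N then G a b else 0))
      (ltnW (ltn_ord n))).
    by apply: eq_bigr => a _; rewrite (@sum_ord_narrow R n' B (G a) (ltnW (ltn_ord n'))).
  apply: eq_bigr => a _; case: ifPn => an; last first.
    by rewrite big1// => b _; rewrite vl// /vd/= (negbTE an) andbF.
  apply: eq_bigr => b _; case: ifPn => bn; last first.
    by rewrite vr// /vd/= (negbTE bn) andbF.
  rewrite /G.
  case: (boolP (coprime a n)) => [can|nan]; last first.
    by rewrite vl// /vd/= (negbTE nan) !andbF.
  case: (boolP (coprime b n')) => [cbn|nbn]; last first.
    by rewrite vr// /vd/= (negbTE nbn) !andbF.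
  by rewrite /v /rho /vd/= Pn Pn' an bn can cbn.
rewrite VE; set S := \sum_(_ < _) _; set V := \sum_(_ < _) _ => H.
have {}H : (2 / 2 ^+ k * S) ^+ 2 <= m * V.
  apply: H => //.
  - by apply: measurable_hits => n /= /PB => /andP[/ltnW].
  - move=> j x /=; rewrite in_itv/= /rho; case: ifPn => [|_]; last first.
      by rewrite subr0 addr0 => /andP[h1 h2]; have := lt_trans h1 h2; rewrite ltxx.
    case: j => n a /= /and3P[Pn an can]; rewrite /ctr/= => /andP[h1 h2].
    have nR := P0 _ Pn; have /andP[p0 p1] := Ppsi _ Pn; have /andP[n1 _] := PB _ Pn.
    (* As [n > 1], the numerator 0 is not coprime to [n]; with [1 <= a <= n - 1] and [psi n <= 1/2]
       the interval stays inside [[0, 1)]. *)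
    have a1 : (0 < a)%N.
      by rewrite lt0n; apply: contraTneq can => ->; rewrite /coprime gcd0n; lia.
    have a1R : 1 <= a%:R :> R by rewrite ler1n.
    have anR : a%:R + 1 <= n%:R :> R by rewrite natr1 ler_nat.
    have pk : psi n / 2 ^+ k <= psi n by rewrite ler_piMr// invf_le1// exprn_ege1// ler1n.
    have {}h1 : a%:R - psi n < n%:R * x.
      apply: (@le_lt_trans _ _ (a%:R - psi n / 2 ^+ k)); first by lra.
      by move: h1; rewrite /rad -mulrBl ltr_pdivrMr// [x * _]mulrC.
    have {}h2 : n%:R * x < a%:R + psi n.
      apply: (@lt_le_trans _ _ (a%:R + psi n / 2 ^+ k)); last by lra.
      by move: h2; rewrite /rad -mulrDl ltr_pdivlMr// [x * _]mulrC.
    split.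
      rewrite /= in_itv/=; apply/andP; split.
        by rewrite -(pmulr_rge0 _ nR); lra.
      by rewrite -(ltr_pM2l nR); lra.
    exists n => //=; exists a%:Z; rewrite ltr_norml pmulrn; apply/andP; split; lra.
  - by move=> j; rewrite mulr_ge0.
  - by move=> j; apply: lebesgue_measure_centered.
  - by move=> i j; apply: lebesgue_measure_centeredI.
have -> : 4 * S ^+ 2 = 4 ^+ k * (2 / 2 ^+ k * S) ^+ 2.
  rewrite (_ : 4 = 2 * 2) ?exprMn; last by rewrite -natrM.
  by field; rewrite gt_eqF.
by rewrite [leRHS]mulrCA ler_wpM2l// exprn_ge0.
Qed.

(* Averaging over the scales [psi / 2^k], [k < K], with weights [4^k] loses nothing
   in measure, since shrinking the intervals only shrinks the set. *)
Lemma block_measure {R : realType} (A : nat) : exists2 c : R, 0 < c &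
  forall K (psi : nat -> R) (P : pred nat), (0 < K)%N ->
  (forall n, P n -> (1 < n < 2 ^ 2 ^ (A * K))%N) ->
  (forall n, P n -> 0 <= psi n <= 1 / 2) ->
  2 ^+ K <= \sum_(0 <= n < 2 ^ 2 ^ (A * K) | P n) psi n * phi_ratio n ->
  (c%:E <= lebesgue_measure (hits psi [set n | P n]))%E.
Proof.
have [C C0 HC] := @overlap_average R A.
exists (4 / (2 + C)) => [|K psi P K0 PB Ppsi].
  by rewrite divr_gt0// addr_gt0.
set B := (2 ^ 2 ^ (A * K))%N in PB *; rewrite big_mkord big_mkcond/=.
pose w n : R := if P n then psi n * phi_ratio n else 0.
set S := \sum_(_ < _) _ => KS.
have P0 n : P n -> (0 < n)%N by move/PB => /andP[/ltnW].
set U := hits psi _.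
have mU : measurable (U : set (measurableTypeR R)) by apply: measurable_hits => n /= /P0.
have U1 : (lebesgue_measure U <= 1%:E)%E by apply: hits_le1 => n /= /P0.
have Ufin : lebesgue_measure U \is a fin_num.
  by rewrite ge0_fin_numE// (le_lt_trans U1)// ltry.
set m := fine (lebesgue_measure U); rewrite -(fineK Ufin) lee_fin -/m.
have m0 : 0 <= m by rewrite fine_ge0.
have S0 : 0 < S by apply: lt_le_trans KS; rewrite exprn_gt0.
have main k := @scale_second_moment R psi P B k m PB Ppsi.
have {}main k : 4 * S ^+ 2 <= m * (4 ^+ k *
    \sum_(n < B) \sum_(n' < B) (if P n && P n' then
      overlap (psi n / 2 ^+ k / n%:R) (psi n' / 2 ^+ k / n'%:R) n n' else 0)).
  by apply: main; rewrite /m fineK.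
(* The diagonal contributes the first term, through the geometric sum of [2^k], and the pairs of
   distinct denominators the second. Since [2^K <= S], the diagonal is absorbed, which leads to
   [c = 4 / (2 + C)]. *)
pose T : R := 2 * 2 ^+ K * S + C * K%:R * S ^+ 2.
suff H : K%:R * (4 * S ^+ 2) <= m * T.
  have KR : 1 <= K%:R :> R by rewrite ler1n.
  have HT : T <= (2 + C) * K%:R * S ^+ 2.
    have h1 : 2 ^+ K * S <= S ^+ 2 by rewrite expr2 ler_pM2r.
    have h2 : S ^+ 2 <= K%:R * S ^+ 2 by rewrite ler_peMl// sqr_ge0.
    by rewrite /T; move: h1 h2; rewrite -!mulrA; nra.
  rewrite ler_pdivrMr ?addr_gt0// -(@ler_pM2r _ (K%:R * S ^+ 2)); last first.
    by rewrite mulr_gt0 ?exprn_gt0//; lra.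
  have := ler_wpM2l m0 HT; move: H; lra.
have -> : K%:R * (4 * S ^+ 2) = \sum_(0 <= k < K) (4 * S ^+ 2).
  by rewrite sumr_const_nat subn0 mulr_natl.
apply: le_trans (ler_sum _ (fun k _ => main k)) _.
rewrite -mulr_sumr ler_wpM2l//.
have w0 n : 0 <= w n.
  rewrite /w; case: ifP => // Pn; have /andP[p0 _] := Ppsi _ Pn.
  by rewrite mulr_ge0// ltW// phi_ratio_gt0.
apply: (@le_trans _ _ (\sum_(n < B) \sum_(n' < B)
    ((if n == n' then 2 * 2 ^+ K * w n else 0) + C * K%:R * (w n * w n')))); last first.
  apply: (@le_trans _ _ (\sum_(n < B) (2 * 2 ^+ K * w n + C * K%:R * (w n * S)))); last first.
    by rewrite big_split/= -!mulr_sumr -mulr_suml /T expr2 lexx.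
  apply: ler_sum => n _; rewrite big_split/= -!mulr_sumr lerD2r.
  rewrite (bigD1 n)//= eqxx big1 ?addr0// => i.
  by rewrite eq_sym => /negbTE ->.
under eq_bigr do rewrite mulr_sumr.
rewrite exchange_big/=; apply: ler_sum => n _.
under eq_bigr do rewrite mulr_sumr.
rewrite exchange_big/=; apply: ler_sum => n' _.
have wC : 0 <= C * K%:R * (w n * w n') by rewrite !mulr_ge0// ltW.
have [/andP[Pn Pn']|nP] := boolP (P n && P n'); last first.
  rewrite big1 ?addr_ge0//; last by move=> k _; rewrite mulr0.
  by case: ifP => // _; rewrite !mulr_ge0// exprn_ge0.
have /andP[pn0 pn1] := Ppsi _ Pn; have /andP[pn'0 pn'1] := Ppsi _ Pn'.
have [/andP[n1 nB] /andP[n'1 n'B]] := (PB _ Pn, PB _ Pn').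
case: eqVneq => [e|nn].
  subst n'; rewrite -[leLHS]addr0; apply: lerD; last exact: wC.
  have nR : 0 < n%:R :> R by rewrite ltr0n P0.
  apply: (@le_trans _ _ (\sum_(0 <= k < K) 2 ^+ k * (2 * w n))).
    apply: ler_sum => k _; have k0 : 0 < 2 ^+ k :> R by rewrite exprn_gt0.
    have k1 : 1 <= 2 ^+ k :> R by rewrite exprn_ege1// ler1n.
    apply: le_trans (ler_wpM2l (exprn_ge0 k (ler0n R 4)) (overlap_diag_le _ _ _)) _.
    - exact: P0.
    - by rewrite !divr_ge0// ltW.
    - rewrite -mulrA mulfVK ?gt_eqF// mulrA ler_pdivrMr//; lra.
    - rewrite totient_phi_ratio ?P0// /w Pn.
      rewrite (_ : 4 = 2 * 2) ?exprMn; last by rewrite -natrM.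
      by rewrite le_eqVlt; apply/orP; left; apply/eqP; field; rewrite !gt_eqF.
  rewrite -mulr_suml.
  by have := ler_wpM2r (mulr_ge0 (ler0n R 2) (w0 n)) (@sum_geometric2 R K); lra.
rewrite add0r /w Pn Pn'.
have := HC K n n' (psi n) (psi n') K0; rewrite P0// nB P0// n'B => /(_ isT isT nn pn0 pn'0).
by move/le_trans; apply; rewrite !mulrA.
Qed.

(** * Finding heavy blocks from the divergence hypothesis *)

Lemma phi_ratio_ge {R : realType} (A : nat) : exists2 c : R, 0 < c &
  forall K n, (0 < K)%N -> (0 < n < 2 ^ (2 * 2 ^ (A * K)))%N -> c <= K%:R * phi_ratio n.
Proof.
have [C C0 HC] := @phi_ratio_upto_le R A; have [D D0 HD] := @mertens_product R.
exists (C * D)^-1 => [|K n K0 nK]; first by rewrite invr_gt0 mulr_gt0.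
have K1 : (1 < 2 ^ K)%N by rewrite -{1}(expn0 2) ltn_exp2l.
have KR : 0 < K%:R :> R by rewrite ltr0n.
have lK : ln (2 ^ K)%:R <= K%:R :> R.
  rewrite natrX lnXn// ler_wMn2r//.
  exact: ln2_le1.
have := HD _ K1; rewrite prodfV; set Q := \prod_(_ <= _ < _ | _) _ => HQ.
have Q0 : 0 < Q by apply: prodr_gt0 => p; exact: prime_factor_gt0.
have QU : Q <= phi_ratio_upto (2 ^ K) n.
  rewrite /phi_ratio_upto big_mkcondr; apply: ler_prod => p pp.
  by rewrite ltW ?prime_factor_gt0//=; case: ifP => // _; exact: prime_factor_le1.
have h : 1 <= D * K%:R * Q.
  rewrite -ler_pdivrMr// div1r; apply: le_trans HQ _; by rewrite ler_wpM2l// ltW.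
rewrite -div1r ler_pdivrMr ?mulr_gt0//; apply: le_trans h _.
rewrite [leRHS](_ : _ = D * K%:R * (C * phi_ratio n)); last by ring.
by rewrite ler_wpM2l ?mulr_ge0 ?(ltW D0)//; apply: le_trans QU (HC _ _ K0 nK).
Qed.

Lemma ln_powR_block_ge {R : realType} (A K n : nat) (eps : R) : 0 < eps -> 4 <= A%:R * eps ->
  (2 ^ 2 ^ (A * K) <= n)%N -> 2 ^+ (4 * K) * ln 2 `^ eps <= ln n%:R `^ eps.
Proof.
move=> e0 Ae nK; have l2 : 0 < ln (2 : R) by rewrite ln_gt0// ltr1n.
have n0 : (0 < n)%N by apply: leq_trans nK; rewrite expn_gt0.
apply: (@le_trans _ _ ((2 ^+ (A * K) * ln 2) `^ eps)); last first.
  apply: ge0_ler_powR; rewrite ?nnegrE ?ln_nat_ge0 ?mulr_ge0 ?exprn_ge0 ?(ltW e0) ?(ltW l2)//.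
  have -> : 2 ^+ (A * K) * ln 2 = ln (2 ^ 2 ^ (A * K))%N%:R :> R.
    by rewrite natrX lnXn// -natrX mulr_natl.
  by rewrite ler_ln ?posrE ?ltr0n ?expn_gt0// ler_nat.
rewrite powRM ?exprn_ge0 ?(ltW l2)// ler_wpM2r ?powR_ge0//.
rewrite -powR_mulrn// -powR_mulrn// -powRrM ler_powR ?ler1n//.
rewrite !natrM mulrAC ler_wpM2r//.
Qed.

(* Blocks [2^2^(AK) <= n < 2^2^(A(K+1))] with [4 <= A * eps]: on such a block
   [(ln n)^eps] exceeds [2^(4K)] up to a constant, so infinitely many blocks have
   [\sum psi n * phi_ratio n >= 2^(K+1)], as [block_measure] requires. *)
Lemma tail_measure {R : realType} (eps : R) : 0 < eps -> exists2 c : R, 0 < c &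
  forall psi : nat -> R, (forall n, (0 < n)%N -> 0 <= psi n <= 1 / 2) ->
  (forall T : R, exists N, T < \sum_(2 <= n < N) psi n / (ln n%:R `^ eps)) ->
  forall M, (c%:E <= lebesgue_measure (hits psi [set n | (0 < n)%N && (M <= n)%N]))%E.
Proof.
move=> e0; pose A := (Num.truncn (4 / eps)).+1.
have Ae : 4 <= A%:R * eps.
  by rewrite -ler_pdivrMr// ltW// truncnS_gt.
have [c c0 Hc] := @block_measure R A; have [d d0 Hd] := @phi_ratio_ge R A.
exists c => // psi psi01 psidiv M.
pose X K := (2 ^ 2 ^ (A * K))%N.
have XK K : (K <= X K)%N.
  apply: leq_trans (ltnW (ltn_expl _ (ltnSn 1))); apply: leq_trans (ltnW (ltn_expl _ (ltnSn 1))).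
  by rewrite leq_pmull.
have XS K : (X K <= X K.+1)%N by rewrite leq_exp2l// leq_exp2l// leq_mul.
have X2 K : (1 < X K)%N by rewrite -{1}(expn0 2) ltn_exp2l// expn_gt0.
have [[K MK HK]|noK] := pselect (exists2 K, (M <= K)%N &
    2 ^+ K.+1 <= \sum_(X K <= n < X K.+1) psi n * phi_ratio n).
  pose P n := (X K <= n < X K.+1)%N.
  apply: (@le_trans _ _ (lebesgue_measure (hits psi [set n | P n]))).
    apply: (Hc K.+1) => //.
    - by move=> n /andP[n1 ->]; rewrite (leq_trans (X2 K)).
    - by move=> n /andP[n1 _]; apply: psi01; apply: leq_trans n1; apply: ltnW.
    - apply: le_trans HK _; rewrite -/(X K.+1) (@big_cat_nat _ _ _ (X K) 0 (X K.+1))//=.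
      rewrite [X in _ <= X + _]big_nat_cond [X in _ <= X + _]big1 ?add0r; last first.
        by move=> n /andP[/andP[_ n1]]; rewrite /P leqNgt n1.
      rewrite [leRHS]big_nat_cond [leLHS]big_nat_cond le_eqVlt; apply/orP; left; apply/eqP.
      by apply: eq_bigl => n; rewrite /P andbT; case: (X K <= n < X K.+1)%N.
  apply: le_measure; rewrite ?inE.
  - apply: measurable_hits => n /= /andP[n1 _]; apply: leq_trans n1; exact: ltnW.
  - by apply: measurable_hits => n /= /andP[].
  - move=> x [x01 [n /= /andP[n1 n2] xn]]; split => //; exists n => //=.
    by rewrite (leq_trans _ n1)/= ?(leq_trans MK) ?(leq_trans (XK K))// ltnW.
exfalso.
pose a n : R := psi n / (ln n%:R `^ eps).
have l2 : 0 < ln (2 : R) by rewrite ln_gt0// ltr1n.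
pose L : R := ln 2 `^ eps.
have L0 : 0 < L by rewrite powR_gt0.
pose C := 2 / (d * L).
have C0 : 0 < C by rewrite divr_gt0// mulr_gt0.
(* A block below the threshold has mass at most [2^(K+1)]. Passing from [psi n * phi_ratio n] to
   [psi n] costs a factor [K + 1], dividing by [(ln n)^eps] gains [2^(4 K)], and the geometric decay
   left over would make the series converge. *)
have blk K : (M <= K)%N -> \sum_(X K <= n < X K.+1) a n <= C / 2 ^+ K.
  move=> MK.
  have p2 : 0 < 2 ^+ K :> R by rewrite exprn_gt0.
  have KR : 0 < K.+1%:R :> R by rewrite ltr0n.
  have bK : \sum_(X K <= n < X K.+1) psi n * phi_ratio n <= 2 ^+ K.+1.
    by rewrite leNgt; apply/negP => h; apply: noK; exists K => //; exact: ltW.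
  apply: (@le_trans _ _ ((K.+1%:R / (d * (2 ^+ (4 * K) * L))) *
      \sum_(X K <= n < X K.+1) psi n * phi_ratio n)).
    rewrite mulr_sumr; apply: ler_sum_nat => n /andP[n1 n2].
    have n0 : (0 < n)%N by apply: leq_trans n1; apply: ltnW.
    have /andP[p0 _] := psi01 n n0.
    have hl := @ln_powR_block_ge R A K n eps e0 Ae n1.
    have hd : d <= K.+1%:R * phi_ratio n.
      by apply: Hd => //; rewrite n0/= (leq_trans n2)// /X leq_exp2l// leq_pmull.
    have E0 : 0 < 2 ^+ (4 * K) * L :> R by rewrite mulr_gt0 ?exprn_gt0.
    rewrite /a ler_pdivrMr; last exact: lt_le_trans hl.
    rewrite [leRHS](_ : _ = psi n * ((K.+1%:R * phi_ratio n) * ln n%:R `^ eps /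
      (d * (2 ^+ (4 * K) * L)))); last by ring.
    rewrite ler_peMr// ler_pdivlMr ?mulr_gt0// mul1r.
    by apply: ler_pM => //; exact: ltW.
  apply: le_trans (ler_wpM2l _ bK) _.
    by rewrite divr_ge0// !mulr_ge0 ?exprn_ge0// ltW.
  have K2 : K.+1%:R <= 2 ^+ K :> R by rewrite -natrX ler_nat ltn_expl.
  have -> : 2 ^+ (4 * K) = (2 ^+ K) ^+ 4 :> R by rewrite mulnC exprM.
  rewrite [2 ^+ K.+1]exprS /C; set q := 2 ^+ K in p2 K2 *.
  have q1 : 1 <= q by apply: le_trans K2; rewrite ler1n.
  rewrite [leLHS](_ : _ = 2 / (d * L) / q * (K.+1%:R / q ^+ 2)); last first.
    by field; rewrite !gt_eqF.
  rewrite ler_piMr ?divr_ge0 ?(ltW (mulr_gt0 d0 L0)) ?(ltW p2)//.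
  rewrite ler_pdivrMr ?exprn_gt0// mul1r expr2.
  by apply: le_trans K2 _; rewrite ler_peMr// ltW.
have part j : \sum_(2 <= n < X (M + j)%N) a n <=
    \sum_(2 <= n < X M) a n + C * (2 - 2 / 2 ^+ (M + j)).
  elim: j => [|j IH].
    rewrite addn0 lerDl mulr_ge0 ?(ltW C0)// subr_ge0 ler_pdivrMr ?exprn_gt0//.
    by rewrite ler_peMr// exprn_ege1// ler1n.
  rewrite addnS (@big_cat_nat _ _ _ (X (M + j)%N) 2 (X (M + j).+1))//=.
  apply: le_trans (lerD IH (blk _ (leq_addr _ _))) _.
  rewrite -addrA lerD2l -mulrDr ler_pM2l// exprS invfM.
  by rewrite le_eqVlt; apply/orP; left; apply/eqP; field; rewrite gt_eqF// exprn_gt0.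
have a0 n : (0 < n)%N -> 0 <= a n.
  by move=> n0; have /andP[p0 _] := psi01 n n0; rewrite divr_ge0// powR_ge0.
have [N] := psidiv (\sum_(2 <= n < X M) a n + C * 2); apply/negP; rewrite -leNgt.
have NX : (N <= X (M + N))%N by apply: leq_trans (XK _); exact: leq_addl.
apply: (@le_trans _ _ (\sum_(2 <= n < X (M + N)%N) a n)).
  have [N2|N2] := leqP 2 N; last first.
    rewrite big_geq; last exact: ltnW.
    by rewrite big_nat_cond sumr_ge0// => n /andP[/andP[/ltnW/a0]].
  rewrite [leRHS](@big_cat_nat _ _ _ N 2 (X (M + N)))//= lerDl big_nat_cond sumr_ge0//.
  by move=> n /andP[/andP[n1 _] _]; apply: a0; lia.
apply: le_trans (part N) _; rewrite lerD2l ler_pM2l// gerBl divr_ge0// exprn_ge0//.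
Qed.

(** * Zero-one law *)

(** [q] times the push-forward of Lebesgue measure agrees with Lebesgue measure on half-open
    intervals, hence on all measurable sets. *)
Lemma lebesgue_measure_affine {R : realType} (q b : R) (A : set R) : 0 < q ->
  measurable (A : set (measurableTypeR R)) ->
  measurable ((fun x => q * x - b) @^-1` A : set (measurableTypeR R)) /\
  (q%:E * lebesgue_measure ((fun x => (q * x - b)%R) @^-1` A) = lebesgue_measure A)%E.
Proof.
move=> q0 mA; pose f : measurableTypeR R -> measurableTypeR R := fun x => q * x - b.
have mf : measurable_fun [set: measurableTypeR R] f.
  by apply: measurable_funB => //; exact: measurable_funM.
split; first by rewrite -[X in measurable X]setTI; exact: mf.
have qn : 0 <= q by exact: ltW.
pose m1 : {measure set (measurableTypeR R) -> \bar R} :=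
  mscale (NngNum qn) [the {measure set _ -> \bar R} of pushforward (@lebesgue_measure R) f].
apply/esym; rewrite (@lebesgue_measure_unique R (m1 mf))// => X [[u v] _ <-] /=.
rewrite /mscale/= /pushforward.
have -> : f @^-1` `]u, v]%classic = `](u + b) / q, (v + b) / q]%classic.
  apply/seteqP; split => x; rewrite /f /= !in_itv/= ltr_pdivrMr// ler_pdivlMr// => /andP[h1 h2];
    apply/andP; split; lra.
rewrite !lebesgue_measure_itv/= !lte_fin ltr_pM2r ?invr_gt0// ltrD2r.
case: ifP => _; last by rewrite mule0.
by rewrite -!EFinB -EFinM; congr (_%:E); field; rewrite gt_eqF.
Qed.

Lemma infinite_natP (S : set nat) :
  infinite_set S <-> forall M, exists2 n, (M <= n)%N & S n.
Proof.
split => [iS M|H fS].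
  apply: contrapT => noM; apply: iS; apply: (@sub_finite_set _ _ `I_M) => // n Sn /=.
  by rewrite ltnNge; apply/negP => Mn; apply: noM; exists n.
have [s Ss] := (finite_seqP _).1 fS.
have [n Mn] := H (\max_(i <- s) i).+1; rewrite Ss /= => ns.
by have := @leq_bigmax_seq _ s xpredT id n ns isT; rewrite leqNgt Mn.
Qed.

Lemma partial_sums_unbounded {R : realType} (u : nat -> R) (N : nat) :
  (forall n, (N <= n)%N -> 0 <= u n) -> (\sum_(N <= n <oo) (u n)%:E = +oo)%E ->
  forall T, exists M, T < \sum_(N <= n < M) u n.
Proof.
move=> u0 uoo T; apply: contrapT => noM.
have : (\sum_(N <= n <oo) (u n)%:E <= T%:E)%E.
  apply: lime_le; first by apply: is_cvg_nneseries => n Nn _; rewrite lee_fin u0.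
  apply: nearW => M; rewrite sumEFin lee_fin leNgt; apply/negP => h.
  by apply: noM; exists M.
by rewrite uoo leye_eq.
Qed.

Lemma near_fraction_le {R : realType} (phi psi : nat -> R) (n : nat) : phi n <= psi n ->
  near_fraction phi n `<=` near_fraction psi n.
Proof. by move=> le x [a h]; exists a; exact: lt_le_trans le. Qed.

Lemma approx_setP {R : realType} (psi : nat -> R) (n : nat) (x : R) :
  (0 < n)%N -> 0 <= psi n <= 1 / 2 -> 0 <= x < 1 ->
  approx_set psi n x <-> near_fraction psi n x.
Proof.
move=> n0 /andP[p0 p1] /andP[x0 x1].
have nR : 0 < n%:R :> R by rewrite ltr0n.
split.
  move=> [y [a _]]; rewrite /= in_itv/= ltr_pdivrMr// ltr_pdivlMr// => /andP[h1 h2] <-.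
  exists (a%:Z - n%:Z * Num.floor y); rewrite /mod1 intrB intrM -!pmulrn.
  rewrite (_ : n%:R * _ - _ = n%:R * y - a%:R); last by ring.
  by rewrite ltr_norml; apply/andP; split; lra.
move=> [a]; rewrite ltr_norml => /andP[h1 h2].
have nx : 0 <= n%:R * x by rewrite mulr_ge0// ltW.
have nx1 : n%:R * x < n%:R by rewrite -[ltRHS]mulr1 ltr_pM2l.
have a0 : 0 <= a.
  suff : -1 < a by lia.
  by rewrite -(ltr_int R) intrN; lra.
have an : a <= n%:Z.
  suff : a < n%:Z + 1 by lia.
  by rewrite -(ltr_int R) intrD -pmulrn; lra.
have floorE (y : R) (m : int) : m%:~R <= y < (m + 1)%:~R -> Num.floor y = m by exact: floor_def.
case: a a0 an h1 h2 => // -[|k] _ an h1 h2.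
  (* The integer numerator 0 is not among [1, ..., n]; it is represented modulo 1 by the numerator
     [n] and the point [x + 1]. *)
  exists (x + 1); last first.
    by rewrite /mod1 (floorE _ 1) ?intrD; [ring | apply/andP; split; lra].
  exists n; first by rewrite /= n0 leqnn.
  rewrite /= in_itv/= ltr_pdivrMr// ltr_pdivlMr//; apply/andP; split; lra.
exists x; last by rewrite /mod1 (floorE _ 0) ?subr0// add0r x0.
exists k.+1 => //=; rewrite in_itv/= ltr_pdivrMr// ltr_pdivlMr//.
by apply/andP; split; move: h1 h2; rewrite -!pmulrn; lra.
Qed.

Lemma well_approximableE {R : realType} (psi : nat -> R) :
  (forall n, (0 < n)%N -> 0 <= psi n <= 1 / 2) ->
  well_approximable psi = \bigcap_M hits psi [set n | (0 < n)%N && (M <= n)%N].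
Proof.
move=> hpsi; apply/seteqP; split => [x [x01 /= /infinite_natP H] M _|x H].
  split => //; have [n Mn [n0 xn]] := H M; exists n; first by rewrite /= n0.
  by apply/(approx_setP n0 (hpsi n n0)); move: x01; rewrite //= in_itv.
have [x01 _] := H 0%N I; split => //=; apply/infinite_natP => M.
have [_ [n /= /andP[n0 Mn] xn]] := H M I; exists n => //; split => //.
by apply/(approx_setP n0 (hpsi n n0)); move: x01; rewrite //= in_itv.
Qed.

(* Each cell [[i/N, (i+1)/N)] is mapped onto [[0, 1)] by [x |-> N x - i], so [V] fills
   at most the proportion [mu V] of it, hence of every interval; covering [V] by
   intervals gives [mu V <= (mu V)^2]. *)
Lemma zero_one_of_invariant {R : realType} (V : set R) :
  measurable (V : set (measurableTypeR R)) -> V `<=` `[0, 1[%classic ->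
  (forall (q : nat) (i : int) (x : R), (0 < q)%N -> V x ->
     0 <= q%:R * x - i%:~R < 1 -> V (q%:R * x - i%:~R)) ->
  (0 < lebesgue_measure V)%E -> (1%:E <= lebesgue_measure V)%E.
Proof.
move=> mV V01 Vinv Vpos.
have mI (b1 b2 : bool) (a b : R) :
    measurable ([set` Interval (BSide b1 a) (BSide b2 b)] : set (measurableTypeR R)).
  exact: measurable_itv.
have V1 : (lebesgue_measure V <= 1%:E)%E.
  rewrite (_ : 1%:E = lebesgue_measure (`[0%R, 1%R[%classic : set R)); last first.
    by rewrite lebesgue_measure_itv/= lte01 sube0.
  by apply: le_measure; rewrite ?inE.
have Vfin : lebesgue_measure V \is a fin_num by rewrite ge0_fin_numE// (le_lt_trans V1)// ltry.
set v := fine (lebesgue_measure V).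
have vE : lebesgue_measure V = v%:E by rewrite fineK.
have v0 : 0 < v by rewrite -lte_fin -vE.
have cell (N : nat) (i : int) : (0 < N)%N ->
    (lebesgue_measure (V `&` `[(i%:~R / N%:R)%R, ((i%:~R + 1) / N%:R)%R[%classic) <= (v / N%:R)%:E)%E.
  move=> N0; have NR : 0 < N%:R :> R by rewrite ltr0n.
  have [mf hf] := @lebesgue_measure_affine R N%:R i%:~R V NR mV.
  apply: (@le_trans _ _ (lebesgue_measure ((fun x => (N%:R * x - i%:~R)%R) @^-1` V))).
    apply: le_measure; rewrite ?inE//; first exact: measurableI.
    move=> x [Vx]; rewrite /= in_itv/= ler_pdivrMr// ltr_pdivlMr// => /andP[h1 h2].
    apply: Vinv => //; apply/andP; split; lra.
  rewrite -(@lee_pmul2l _ N%:R%:E)// ?lte_fin// hf vE -EFinM lee_fin.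
  by rewrite mulrC divfK// gt_eqF.
have cells (N : nat) (i : int) (k : nat) : (0 < N)%N ->
    (lebesgue_measure (V `&` `[(i%:~R / N%:R)%R, ((i%:~R + k%:R) / N%:R)%R[%classic) <=
     (k%:R * (v / N%:R))%:E)%E.
  move=> N0; have NR : 0 < N%:R :> R by rewrite ltr0n.
  elim: k => [|k IH].
    by rewrite addr0 mul0r set_itv_ge ?setI0 ?measure0// bnd_simp ltxx.
  have := leeD IH (cell N (i + k%:Z) N0).
  rewrite -EFinD (_ : k%:R * _ + _ = k.+1%:R * (v / N%:R)); last by rewrite -natr1; ring.
  apply: le_trans.
  apply: le_trans (measureU2 _ _ _); [|exact: measurableI..].
  apply: le_measure; rewrite ?inE; [exact: measurableI | by apply: measurableU; exact: measurableI |].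
  move=> x [Vx]; rewrite /= !in_itv/= intrD -pmulrn -addrA => /andP[h1 h2].
  by have [xk|xk] := ltP x ((i%:~R + k%:R) / N%:R); [left|right]; split => //;
    rewrite ?h1 ?xk//= natr1.
have itv (a b : R) : a < b -> (lebesgue_measure (V `&` `]a, b[%classic) <= (v * (b - a))%:E)%E.
  move=> ab; apply/lee_addgt0Pr => e e0.
  (* At most [N (b - a) + 2] cells of length [1/N] cover the interval, so the excess is [2 v / N],
     made at most [e] by this choice. *)
  pose N := (Num.truncn (2 * v / e)).+1.
  have NR : 0 < N%:R :> R by rewrite ltr0n.
  have Ne : 2 * v / N%:R <= e.
    by rewrite ler_pdivrMr// [e * _]mulrC -ler_pdivrMr// ltW// truncnS_gt.
  pose i := Num.floor (N%:R * a); pose j := Num.floor (N%:R * b).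
  have ij : i <= j by apply: le_floor; rewrite ler_pM2l// ltW.
  have [k kE] : exists k : nat, j = i + k%:Z by exists `|j - i|%N; lia.
  have /andP[ia1 ia2] : i%:~R <= N%:R * a < i%:~R + 1 by have := floor_itv (N%:R * a); rewrite intrD.
  have /andP[jb1 jb2] : j%:~R <= N%:R * b < j%:~R + 1 by have := floor_itv (N%:R * b); rewrite intrD.
  have jR : j%:~R = i%:~R + k%:R :> R by rewrite kE intrD -pmulrn.
  apply: (@le_trans _ _ (k.+1%:R * (v / N%:R))%:E).
    apply: le_trans (cells N i k.+1 isT); apply: le_measure; rewrite ?inE; [exact: measurableI..|].
    move=> x [Vx]; rewrite /= !in_itv/= => /andP[h1 h2]; split => //.
    rewrite ler_pdivrMr// ltr_pdivlMr//; apply/andP; split; first by nra.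
    by apply: (@lt_trans _ _ (b * N%:R)); rewrite ?ltr_pM2r// -natr1; lra.
  rewrite -EFinD lee_fin; apply: (@le_trans _ _ (v * (b - a) + 2 * v / N%:R)); last by rewrite lerD2l.
  rewrite (_ : v * (b - a) + 2 * v / N%:R = (N%:R * b - N%:R * a + 2) * (v / N%:R)); last first.
    by field; rewrite gt_eqF.
  by rewrite ler_wpM2r ?divr_ge0 ?(ltW v0)// -natr1; lra.
(* By the definition of outer measure, [V] has a cover by open intervals of total length below
   [v + e], and [V] fills at most the proportion [v] of each. *)
have key (e : R) : 0 < e -> v <= v * (v + e).
  move=> e0; have Vo : ((wlength idfun)^*%mu V = v%:E)%E := vE.
  have := outer_measure_open_itv_cover V; rewrite Vo => Vinf.
  have [|x [F [Fitv VF] <-]] := @lb_ereal_inf_adherent R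
      [set \big[+%E/0%E]_(0 <= k <oo) wlength idfun (F k) | F in open_itv_cover V] e e0.
    by rewrite -Vinf.
  rewrite -Vinf -EFinD => lt.
  have mF k : measurable (F k : set (measurableTypeR R)).
    by have [ab ->] := Fitv k.
  have Fk k : (lebesgue_measure (V `&` F k) <= v%:E * wlength idfun (F k))%E.
    have [[a b] /= ->] := Fitv k; have [ab|ba] := ltP a b; last first.
      by rewrite set_itv_ge ?setI0 ?measure0 ?wlength0 ?mule0// bnd_simp -leNgt.
    by rewrite wlength_itv/= lte_fin ab; exact: itv.
  have : (v%:E <= \sum_(0 <= k <oo) v%:E * wlength idfun (F k))%E.
    rewrite -[leLHS]vE; apply: (@le_trans _ _ (\sum_(0 <= k <oo) lebesgue_measure (V `&` F k))%E).
      apply: measure_sigma_subadditive => //; first by move=> k; exact: measurableI.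
      by move=> y Vy; have [k _ Fy] := VF _ Vy; exists k.
    by apply: lee_nneseries.
  rewrite nneseriesZl; last by move=> k _; exact: wlength_ge0.
  move=> h; rewrite -lee_fin EFinM; apply: le_trans h _.
  by rewrite lee_pmul2l ?lte_fin// ltW.
rewrite vE lee_fin; apply/ler_addgt0Pr => e e0; have := key e e0.
by rewrite -{1}[v]mulr1 ler_pM2l.
Qed.

Theorem theorem1 (R : realType) (psi : nat -> R)
  (hpsi : forall n : nat, (0 < n)%N -> 0 <= psi n <= 1 / 2)
  (hdiv : exists2 eps : R, 0 < eps &
    (\sum_(2 <= n <oo) (psi n / (ln n%:R `^ eps))%:E = +oo)%E) :
  lebesgue_measure (well_approximable psi) = 1%E.
Proof.
have [eps e0 sumoo] := hdiv.
have [c c0 Hc] := tail_measure e0.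
pose P M : set nat := [set n | (0 < n)%N && (M <= n)%N].
have P0 M n : P M n -> (0 < n)%N by case/andP.
(* One index serves both the scaling and the starting denominator, so the sets decrease and
   continuity from above passes the bound [c] to their intersection. *)
pose F M : set (measurableTypeR R) := hits (fun n => psi n / M.+1%:R) (P M).
have mF M : measurable (F M) by apply: measurable_hits; exact: P0.
have mW : measurable (well_approximable psi : set (measurableTypeR R)).
  rewrite well_approximableE//; apply: bigcapT_measurable => M.
  by apply: measurable_hits; exact: P0.
have Sc j : forall n, (0 < n)%N -> 0 <= psi n / j.+1%:R <= 1 / 2.
  move=> n n0; have /andP[p0 p1] := hpsi n n0; have j0 : 0 < j.+1%:R :> R by rewrite ltr0n.
  rewrite divr_ge0//= (le_trans _ p1)// ler_pdivrMr// ler_peMr// ler1n//.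
have Fc M : (c%:E <= lebesgue_measure (F M))%E.
  apply: Hc; first exact: Sc.
  move=> T; have j0 : 0 < M.+1%:R :> R by rewrite ltr0n.
  have [|N HN] := partial_sums_unbounded _ sumoo (T * M.+1%:R).
    move=> n n2; have /andP[p0 _] := hpsi n (ltnW n2).
    by rewrite divr_ge0// powR_ge0.
  exists N; rewrite -(ltr_pM2r j0); apply: lt_le_trans HN _.
  rewrite mulr_suml le_eqVlt; apply/orP; left; apply/eqP; apply: eq_bigr => n _.
  by rewrite mulrAC divfK// gt_eqF.
(* The constant [c] does not depend on the scaling of [psi], and dividing by all
   [M + 1] makes the limit set invariant under multiplication by integers. *)
pose V := \bigcap_M F M.
have mV : measurable V by exact: bigcapT_measurable.
have VW : V `<=` well_approximable psi.
  rewrite well_approximableE// => x Vx M _; have [x01 [n Pn xn]] := Vx M I.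
  split => //; exists n => //; apply: near_fraction_le xn.
  have /andP[p0 _] := hpsi n (P0 _ _ Pn).
  by rewrite ler_pdivrMr ?ltr0n// ler_peMr// ler1n.
have V01 : V `<=` `[0, 1[%classic by move=> x /(_ 0%N I)[].
have Vc : (c%:E <= lebesgue_measure V)%E.
  have Fdec : {homo F : n m / (n <= m)%N >-> (m <= n)%O}.
    move=> M M' MM'; rewrite subsetEset => x [x01 [n /andP[n0 Mn] xn]]; split => //.
    exists n; first by rewrite /P/= n0 (leq_trans MM').
    apply: near_fraction_le xn; have /andP[p0 _] := hpsi n n0.
    by rewrite ler_wpM2l// lef_pV2 ?posrE ?ltr0n// ler_nat.
  have cvgF := @nonincreasing_cvg_mu _ _ _ (@lebesgue_measure R) F _ mF mV Fdec.
  rewrite -(cvg_lim _ (cvgF _))//; last first.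
    by apply: le_lt_trans (ltry 1); apply: hits_le1; exact: P0.
  apply: lime_ge; last by apply: nearW => M; exact: Fc.
  by apply: cvgP; apply: cvgF; apply: le_lt_trans (ltry 1); apply: hits_le1; exact: P0.
have V1 : (1%:E <= lebesgue_measure V)%E.
  apply: zero_one_of_invariant => //; last by apply: lt_le_trans Vc; rewrite lte_fin.
  move=> q i x q0 Vx x01 M _; split => //.
  have [_ [n /andP[n0 Mn] [a xa]]] := Vx (q * M.+1)%N I.
  exists n; first by rewrite /P/= n0 (leq_trans _ Mn)// (leq_trans (leqnSn M))// leq_pmull.
  exists (q%:Z * a - n%:Z * i).
  have qR : 0 < q%:R :> R by rewrite ltr0n.
  have /andP[p0 _] := hpsi n n0.
  rewrite intrB !intrM -!pmulrn.
  rewrite (_ : n%:R * _ - _ = q%:R * (n%:R * x - a%:~R)); last by ring.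
  rewrite normrM gtr0_norm// -ltr_pdivlMl//; apply: lt_le_trans xa _.
  rewrite mulrCA ler_wpM2l// -invfM lef_pV2 ?posrE ?mulr_gt0 ?ltr0n//.
  by rewrite -natrM ler_nat.
apply/eqP; rewrite eq_le; apply/andP; split; last first.
  by apply: le_trans V1 _; apply: le_measure; rewrite ?inE.
rewrite well_approximableE// in mW *.
apply: le_trans (hits_le1 psi (P0 0%N)); apply: le_measure; rewrite ?inE//.
  by apply: measurable_hits; exact: P0.
by move=> x /(_ 0%N I).
Qed.
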